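(* Let $F_2$ be the free group on two generators $(t_1,t_2)=(u,v)$. (i) A surjective endomorphism of $F_2$ is an automorphism. (ii) The group of direct automorphisms of $F_2$ is the semidirect product along $\psi$ of $\mathrm{Int}(F_2)$ by $B_3$, amalgamated over the subgroup $Y$ of index $2$ in the center of $B_3$: $$\mathrm{Aut}^+(F_2)=\mathrm{Int}(F_2)\rtimes_{\psi,\ \langle\varphi_{[t_1,t_2]}=s^4\rangle}B_3,$$ that is, $(h,x)\mapsto h\circ x$ induces an isomorphism from this amalgamated semidirect product onto $\mathrm{Aut}^+(F_2)$. (iii) The group $\mathrm{Int}(F_2)$ of inner automorphisms of $F_2$ is the kernel of $\rho:\mathrm{Aut}(F_2)\to\mathrm{Aut}(\mathbb{Z}^2)=GL(2,\mathbb{Z})$. (iv) An endomorphism $\varphi:F_2\to F_2$, $\varphi(t_i)=X_i$, $i=1,2$, is a direct automorphism of $F_2$ if and only if it preserves the commutator of the generators up to conjugation, i.e. there is $w\in F_2$ with $$[X_1,X_2]=X_1^{-1}X_2^{-1}X_1X_2=w^{-1}[t_1,t_2]w.$$ Moreover, $\varphi$ lies in $B_3$ if and only if $[X_1,X_2]=[t_1,t_2]$.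
   Context: Conventions: $[x,y]=x^{-1}y^{-1}xy$; $\varphi_x\in\mathrm{Int}(F_2)$ is $y\mapsto xyx^{-1}$. The morphism $\rho:\mathrm{Aut}(F_2)\to GL(2,\mathbb{Z})$ is induced by abelianization $F_2\to\mathbb{Z}^2$, and $\mathrm{Aut}^+(F_2)=\rho^{-1}(SL(2,\mathbb{Z}))$ is the group of direct automorphisms. $B_3=\langle a,b\mid aba=bab\rangle$, $s=aba=bab$, with center $Z=\langle s^2\rangle$, is identified with a subgroup of $\mathrm{Aut}(F_2)$ via the injective morphism $a\mapsto\alpha$, $b\mapsto\beta$, where $\alpha(u)=u,\ \alpha(v)=u^{-1}v$ and $\beta(u)=vu,\ \beta(v)=v$. Under this identification $s^4=\varphi_{[t_1,t_2]}$. $Y=\langle s^4\rangle$ is the subgroup of index $2$ of $Z$, identified with $\langle\varphi_{[t_1,t_2]}\rangle\subset\mathrm{Int}(F_2)$ by $s^4\mapsto\varphi_{[t_1,t_2]}$. The morphism $\psi:B_3\to\mathrm{Aut}(\mathrm{Int}(F_2))$ is $\psi(x):h\mapsto x\circ h\circ x^{-1}$. Amalgamated semidirect product: $K\rtimes_\psi L$ is $K\times L$ with law $(k,l)(k',l')=(k\,\psi(l)(k'),ll')$; if $M$ is identified with a common subgroup of $K$ and $L$, normal in $L$, such that $\psi(l)(m)=lml^{-1}$ and $\psi(m)(k)=mkm^{-1}$ for all $k\in K,\ l\in L,\ m\in M$, then $\mu(M)=\{(m^{-1},m)\mid m\in M\}$ is normal in $K\rtimes_\psi L$, and the semidirect product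 amalgamated over $M$ is $K\rtimes_{\psi,M}L:=(K\rtimes_\psi L)/\mu(M)$. Here $K=\mathrm{Int}(F_2)$, $L=B_3$, $M=Y$. *)

(* Defs.v *)
Set Warnings "-notation-overridden,-ambiguous-paths,-redundant-canonical-projection,-projection-no-head-constant".
From HB Require Import structures.
From mathcomp Require Import all_boot all_order all_algebra.
From mathcomp Require Import boolp.

Set Implicit Arguments.
Unset Strict Implicit.
Unset Printing Implicit Defensive.

Import GRing.Theory.
Local Open Scope group_scope.

(* Throughout, as in the library, [~ x, y] is x^-1 * y^-1 * x * y and x ^ y is
   y^-1 * x * y. Between groups, unital magma morphisms are exactly the group
   homomorphisms. *)
Notation "{ 'hom' G -> H }" := (UMagmaMorphism.type G%type H%type)
  (at level 0, G at level 98, H at level 99) : type_scope.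

Section Subgroup.
Variables (G : groupType) (S : groupClosed G).

Record subgroup := Subgroup { sub_val :> G; sub_valP : sub_val \in S }.

HB.instance Definition _ := [isSub of subgroup for sub_val].
HB.instance Definition _ := [Choice of subgroup by <:].

Fact subgroup_closed : group_closed (mem S).
Proof. by split; [exact: gpred1 | move=> x y; exact: gpredF]. Qed.

HB.instance Definition _ :=
  SubChoice_isSubGroup.Build G (mem S) subgroup subgroup_closed.

End Subgroup.

Section Restrict.
Variables (G H : groupType) (S : groupClosed G) (T : groupClosed H).
Variables (f : {hom G -> H}) (fST : forall x, x \in S -> f x \in T).

Definition restrict (x : subgroup S) : subgroup T :=
  Subgroup (fST (valP x)).

Fact restrict_morphism : monoid.monoid_morphism restrict.
Proof.
split=> [|x y]; apply: val_inj; first by rewrite /= gmulf1.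
by rewrite /= gmulfM.
Qed.
HB.instance Definition _ := isUMagmaMorphism.Build _ _ restrict restrict_morphism.

End Restrict.

HB.mixin Record isNormal (G : groupType) (S : {pred G}) := {
  normalJ : forall x y : G, x \in S -> x ^ y \in S
}.

#[short(type="normalClosed")]
HB.structure Definition NormalClosed (G : groupType) :=
  {S of GroupClosed G S & isNormal G S}.

Section Quotient.
Variables (G : groupType) (N : normalClosed G).

Definition coset_rel : rel G := fun x y => x^-1 * y \in N.

Fact coset_rel_refl : reflexive coset_rel.
Proof. by move=> x; rewrite /coset_rel mulVg gpred1. Qed.

Fact coset_rel_sym : symmetric coset_rel.
Proof. by move=> x y; rewrite /coset_rel -gpredV invgM invgK. Qed.

Fact coset_rel_trans : transitive coset_rel.
Proof.
move=> y x z; rewrite /coset_rel => xy yz.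
by have := gpredM _ _ xy yz; rewrite mulgA mulgK.
Qed.

Canonical coset_equiv :=
  EquivRel coset_rel coset_rel_refl coset_rel_sym coset_rel_trans.

Definition quotient : Type := {eq_quot coset_rel}%qT.
HB.instance Definition _ := Choice.on quotient.

Definition cls (x : G) : quotient := (\pi_({eq_quot coset_rel}) x)%qT.
Definition cls_repr (q : quotient) : G := repr (q : {eq_quot coset_rel}%qT).

Lemma clsK q : cls (cls_repr q) = q.
Proof. exact: reprK. Qed.

Lemma clsP x y : reflect (cls x = cls y) (x^-1 * y \in N).
Proof. exact: (@eqmodP _ coset_equiv). Qed.

Definition qmul (p q : quotient) := cls (cls_repr p * cls_repr q).
Definition qinv (p : quotient) := cls (cls_repr p)^-1.

Lemma clsM x y : qmul (cls x) (cls y) = cls (x * y).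
Proof.
apply/clsP; set x' := cls_repr _; set y' := cls_repr _.
have /clsP xx' : cls x' = cls x by rewrite clsK.
have /clsP yy' : cls y' = cls y by rewrite clsK.
have := gpredM _ _ (normalJ _ y' xx') yy'.
by rewrite conjgE !invgM !mulgA mulgK.
Qed.

Lemma clsV x : qinv (cls x) = cls x^-1.
Proof.
apply/clsP; set x' := cls_repr _.
have /clsP xx' : cls x = cls x' by rewrite clsK.
by have := normalJ _ x^-1 xx'; rewrite conjgE !invgK !mulgA mulgV mul1g.
Qed.

Fact qmulA : associative qmul.
Proof.
by move=> p q r; rewrite -(clsK p) -(clsK q) -(clsK r) !clsM mulgA.
Qed.
Fact qmul1 : left_id (cls 1) qmul.
Proof. by move=> p; rewrite -(clsK p) clsM mul1g. Qed.
Fact qmulr1 : right_id (cls 1) qmul.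
Proof. by move=> p; rewrite -(clsK p) clsM mulg1. Qed.
Fact qmulV : left_inverse (cls 1) qinv qmul.
Proof. by move=> p; rewrite -(clsK p) clsV clsM mulVg. Qed.
Fact qmulrV : right_inverse (cls 1) qinv qmul.
Proof. by move=> p; rewrite -(clsK p) clsV clsM mulgV. Qed.

HB.instance Definition _ :=
  isGroup.Build quotient qmulA qmul1 qmulr1 qmulV qmulrV.

Fact cls_morphism : monoid.monoid_morphism cls.
Proof. by split=> // x y; rewrite -clsM. Qed.
HB.instance Definition _ := isUMagmaMorphism.Build _ _ cls cls_morphism.

Variables (H : groupType) (f : {hom G -> H}).
Hypothesis fN : forall x, x \in N -> f x = 1.

Definition quotient_lift_fun (q : quotient) : H := f (cls_repr q).

Fact quotient_lift_funE x : quotient_lift_fun (cls x) = f x.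
Proof.
have /clsP/fN : cls (cls_repr (cls x)) = cls x by rewrite clsK.
by rewrite gmulfM gmulfV => /mulg1_eq; rewrite invgK.
Qed.

Fact quotient_lift_morphism : monoid.monoid_morphism quotient_lift_fun.
Proof.
split=> [|p q]; first by rewrite quotient_lift_funE gmulf1.
by rewrite -(clsK p) -(clsK q) -gmulfM !quotient_lift_funE gmulfM.
Qed.

Definition quotient_lift : {hom quotient -> H} :=
  HB.pack quotient_lift_fun
    (isUMagmaMorphism.Build _ _ quotient_lift_fun quotient_lift_morphism).

Lemma quotient_liftE x : quotient_lift (cls x) = f x.
Proof. exact: quotient_lift_funE. Qed.

End Quotient.
Arguments cls {G} N.

Section NormalClosure.
Variables (G : groupType) (R : {pred G}).

Definition normal_closure : {pred G} :=
  fun x => `[< forall N : normalClosed G, {subset R <= N} -> x \in N >].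

Lemma normal_closureP x :
  reflect (forall N : normalClosed G, {subset R <= N} -> x \in N)
          (x \in normal_closure).
Proof. exact: asboolP. Qed.

Fact normal_closure1 : 1 \in normal_closure.
Proof. by apply/normal_closureP => N _; apply: gpred1. Qed.
Fact normal_closureM : mulg_closed normal_closure.
Proof.
move=> x y /normal_closureP Nx /normal_closureP Ny.
by apply/normal_closureP => N RN; rewrite gpredM ?Nx ?Ny.
Qed.
Fact normal_closureV : invg_closed normal_closure.
Proof.
move=> x /normal_closureP Nx.
by apply/normal_closureP => N RN; rewrite gpredV Nx.
Qed.
Fact normal_closureJ x y : x \in normal_closure -> x ^ y \in normal_closure.
Proof.
move=> /normal_closureP Nx.
by apply/normal_closureP => N RN; rewrite normalJ ?Nx.
Qed.

HB.instance Definition _ := isMulClosed.Build G normal_closure normal_closureM.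
HB.instance Definition _ := isMul1Closed.Build G normal_closure normal_closure1.
HB.instance Definition _ := isInvClosed.Build G normal_closure normal_closureV.
HB.instance Definition _ := isNormal.Build G normal_closure normal_closureJ.

End NormalClosure.

Section Kernel.
Variables (G H : groupType) (f : {hom G -> H}).

Definition kernel : {pred G} := fun x => f x == 1.

Fact kernel1 : 1 \in kernel.
Proof. by rewrite unfold_in gmulf1. Qed.
Fact kernelM : mulg_closed kernel.
Proof. by move=> x y /eqP fx /eqP fy; rewrite unfold_in gmulfM fx fy mulg1. Qed.
Fact kernelV : invg_closed kernel.
Proof. by move=> x /eqP fx; rewrite unfold_in gmulfV fx invg1. Qed.
Fact kernelJ x y : x \in kernel -> x ^ y \in kernel.
Proof. by move=> /eqP fx; rewrite unfold_in gmulfJ /= fx conj1g. Qed.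

HB.instance Definition _ := isMulClosed.Build G kernel kernelM.
HB.instance Definition _ := isMul1Closed.Build G kernel kernel1.
HB.instance Definition _ := isInvClosed.Build G kernel kernelV.
HB.instance Definition _ := isNormal.Build G kernel kernelJ.

End Kernel.

Section Cyclic.
Variables (G : groupType) (g : G).

Definition cyclic_subgroup : {pred G} :=
  fun x => `[< exists n : nat, x = g ^+ n \/ x = g ^- n >].

Lemma cyclic_subgroupP x :
  reflect (exists n : nat, x = g ^+ n \/ x = g ^- n) (x \in cyclic_subgroup).
Proof. exact: asboolP. Qed.

Fact cyclic_subgroup1 : 1 \in cyclic_subgroup.
Proof. by apply/cyclic_subgroupP; exists 0; left. Qed.
Fact cyclic_subgroupV : invg_closed cyclic_subgroup.
Proof.
move=> x /cyclic_subgroupP[n [] ->]; apply/cyclic_subgroupP; exists n; first by right.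
by left; rewrite invgK.
Qed.
Fact cyclic_subgroupF m n : g ^+ m / g ^+ n \in cyclic_subgroup.
Proof.
case: (leqP n m) => [nm|/ltnW mn]; apply/cyclic_subgroupP.
  by exists (m - n); left; rewrite expgnFr.
by exists (n - m); right; rewrite expgnFr // invgF.
Qed.
Fact cyclic_subgroupM : mulg_closed cyclic_subgroup.
Proof.
move=> x y /cyclic_subgroupP[m [] ->] /cyclic_subgroupP[n [] ->].
- by apply/cyclic_subgroupP; exists (m + n)%N; left; rewrite expgnDr.
- exact: cyclic_subgroupF.
- have -> : g ^- m * g ^+ n = g ^+ n / g ^+ m; last exact: cyclic_subgroupF.
  by apply/esym/commuteV/commuteX2.
by apply/cyclic_subgroupP; exists (n + m)%N; right; rewrite expgnDr invgM.
Qed.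

HB.instance Definition _ := isMulClosed.Build G cyclic_subgroup cyclic_subgroupM.
HB.instance Definition _ := isMul1Closed.Build G cyclic_subgroup cyclic_subgroup1.
HB.instance Definition _ := isInvClosed.Build G cyclic_subgroup cyclic_subgroupV.

End Cyclic.

(* Equality of automorphisms is pointwise equality (aut_eqP), and the group law
   f * g is the composition f \o g (autME). *)
Record aut (G : groupType) := Aut {
  aut_fun :> G -> G;
  aut_inv : G -> G;
  aut_morphism : monoid.monoid_morphism aut_fun;
  aut_funK : cancel aut_fun aut_inv;
  aut_invK : cancel aut_inv aut_fun
}.

HB.instance Definition _ (G : groupType) := gen_eqMixin (aut G).
HB.instance Definition _ (G : groupType) := gen_choiceMixin (aut G).

HB.instance Definition _ (G : groupType) (f : aut G) :=
  isUMagmaMorphism.Build G G (aut_fun f) (aut_morphism f).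

Lemma aut_eqP (G : groupType) (f g : aut G) : f =1 g -> f = g.
Proof.
case: f g => f f' mf fK f'K [g g' mg gK g'K] /= fg.
have {}fg : f = g by apply/funext.
subst g.
have fg' : f' = g' by apply/funext => x; apply: (can_inj fK); rewrite f'K g'K.
by subst g'; congr Aut; apply: Prop_irrelevance.
Qed.

Section AutGroup.
Variable G : groupType.
Implicit Types f g h : aut G.

Definition aut_one : aut G :=
  @Aut G idfun idfun (erefl, fun _ _ => erefl) (fun=> erefl) (fun=> erefl).

Fact aut_comp_morphism f g : monoid.monoid_morphism (f \o g).
Proof. by split=> [|x y]; rewrite /= ?gmulf1 ?gmulfM. Qed.

Definition aut_mul f g : aut G :=
  Aut (aut_comp_morphism f g) (can_comp (aut_funK f) (aut_funK g))
      (can_comp (aut_invK g) (aut_invK f)).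

Fact aut_inv_morphism f : monoid.monoid_morphism (aut_inv f).
Proof.
split=> [|x y]; first by apply: (can_inj (aut_funK f)); rewrite aut_invK (aut_morphism f).1.
by apply: (can_inj (aut_funK f)); rewrite [LHS]aut_invK (aut_morphism f).2 !aut_invK.
Qed.

Definition aut_opp f : aut G :=
  Aut (aut_inv_morphism f) (aut_invK f) (aut_funK f).

Fact aut_mulA : associative aut_mul.
Proof. by move=> f g h; apply: aut_eqP. Qed.
Fact aut_mul1 : left_id aut_one aut_mul.
Proof. by move=> f; apply: aut_eqP. Qed.
Fact aut_mulr1 : right_id aut_one aut_mul.
Proof. by move=> f; apply: aut_eqP. Qed.
Fact aut_mulV : left_inverse aut_one aut_opp aut_mul.
Proof. by move=> f; apply: aut_eqP => x; apply: aut_funK. Qed.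
Fact aut_mulrV : right_inverse aut_one aut_opp aut_mul.
Proof. by move=> f; apply: aut_eqP => x; apply: aut_invK. Qed.

HB.instance Definition _ :=
  isGroup.Build (aut G) aut_mulA aut_mul1 aut_mulr1 aut_mulV aut_mulrV.

Lemma autME f g x : (f * g) x = f (g x). Proof. by []. Qed.
Lemma aut1E x : (1 : aut G) x = x. Proof. by []. Qed.
Lemma autVE f x : f^-1 x = aut_inv f x. Proof. by []. Qed.

End AutGroup.

Section Inner.
Variable G : groupType.

Fact inn_morphism (x : G) : monoid.monoid_morphism (fun y => x * y * x^-1).
Proof. by split=> [|y z]; rewrite ?mulg1 ?mulgV // !mulgA mulgVK. Qed.
Fact inn_funK (x : G) : cancel (fun y => x * y * x^-1) (fun y => x^-1 * y * x).
Proof. by move=> y /=; rewrite !mulgA mulVg mul1g mulgVK. Qed.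
Fact inn_invK (x : G) : cancel (fun y => x^-1 * y * x) (fun y => x * y * x^-1).
Proof. by move=> y /=; rewrite !mulgA mulgV mul1g mulgK. Qed.

Definition inn (x : G) : aut G :=
  Aut (inn_morphism x) (inn_funK x) (inn_invK x).

Fact inn_is_morphism : monoid.monoid_morphism inn.
Proof.
split=> [|x y]; apply: aut_eqP => z; first by rewrite /= mul1g divg1.
by rewrite /= invgM !mulgA.
Qed.
HB.instance Definition _ := isUMagmaMorphism.Build _ _ inn inn_is_morphism.

Lemma innJ (f : aut G) x : f * inn x * f^-1 = inn (f x).
Proof.
apply: aut_eqP => y.
rewrite !autME autVE [LHS]/=.
by rewrite !(aut_morphism f).2 gmulfV aut_invK.
Qed.

Definition inner : {pred aut G} := fun f => `[< exists x, f = inn x >].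

Lemma innerP f : reflect (exists x, f = inn x) (f \in inner).
Proof. exact: asboolP. Qed.

Fact inner1 : 1 \in inner.
Proof. by apply/innerP; exists 1; rewrite gmulf1. Qed.
Fact innerM : mulg_closed inner.
Proof.
move=> _ _ /innerP[x ->] /innerP[y ->]; apply/innerP; exists (x * y).
by rewrite gmulfM.
Qed.
Fact innerV : invg_closed inner.
Proof.
by move=> _ /innerP[x ->]; apply/innerP; exists x^-1; rewrite gmulfV.
Qed.
Fact innerJ f g : f \in inner -> f ^ g \in inner.
Proof.
move=> /innerP[x ->]; apply/innerP; exists (g^-1 x).
by rewrite -innJ invgK conjgE mulgA.
Qed.

HB.instance Definition _ := isMulClosed.Build (aut G) inner innerM.
HB.instance Definition _ := isMul1Closed.Build (aut G) inner inner1.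
HB.instance Definition _ := isInvClosed.Build (aut G) inner innerV.
HB.instance Definition _ := isNormal.Build (aut G) inner innerJ.

End Inner.
Arguments inner : clear implicits.

Notation Int G := (subgroup (inner G)).

Section ConjugationAction.
Variables (G : groupType) (N : normalClosed G).

Fact conj_on_in (x : G) (h : subgroup N) : x * val h * x^-1 \in N.
Proof. by have := normalJ _ x^-1 (valP h); rewrite conjgE invgK mulgA. Qed.

Definition conj_on_fun x (h : subgroup N) : subgroup N :=
  Subgroup (conj_on_in x h).

Fact conj_on_morphism x : monoid.monoid_morphism (conj_on_fun x).
Proof.
split=> [|y z]; apply: val_inj; rewrite /= ?mulg1 ?mulgV //.
by rewrite !mulgA mulgVK.
Qed.
Fact conj_on_funK x : cancel (conj_on_fun x) (conj_on_fun x^-1).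
Proof.
by move=> h; apply: val_inj; rewrite /= invgK !mulgA mulVg mul1g mulgVK.
Qed.
Fact conj_on_invK x : cancel (conj_on_fun x^-1) (conj_on_fun x).
Proof. by move=> h; rewrite -{1}[x]invgK conj_on_funK. Qed.

Definition conj_on (x : G) : aut (subgroup N) :=
  Aut (conj_on_morphism x) (conj_on_funK x) (conj_on_invK x).

Fact conj_on_is_morphism : monoid.monoid_morphism conj_on.
Proof.
split=> [|x y]; apply: aut_eqP => h; apply: val_inj.
  by rewrite /= mul1g divg1.
by rewrite /= invgM !mulgA.
Qed.
HB.instance Definition _ := isUMagmaMorphism.Build _ _ conj_on conj_on_is_morphism.

End ConjugationAction.
Arguments conj_on {G} N.

Record sdprod (K L : groupType) (psi : {hom L -> aut K}) := SDPair {
  sd_l : K;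
  sd_r : L
}.

Section SemidirectProduct.
Variables (K L : groupType) (psi : {hom L -> aut K}).
Local Notation sdp := (sdprod psi).

Definition pair_of_sdprod (p : sdp) := (sd_l p, sd_r p).
Definition sdprod_of_pair (p : K * L) : sdp := SDPair psi p.1 p.2.
Fact pair_of_sdprodK : cancel pair_of_sdprod sdprod_of_pair.
Proof. by case. Qed.

HB.instance Definition _ := Choice.copy sdp (can_type pair_of_sdprodK).

Definition sd_mul (p q : sdp) : sdp :=
  SDPair psi (sd_l p * psi (sd_r p) (sd_l q)) (sd_r p * sd_r q).
Definition sd_one : sdp := SDPair psi 1 1.
Definition sd_inv (p : sdp) : sdp :=
  SDPair psi (psi (sd_r p)^-1 (sd_l p)^-1) (sd_r p)^-1.

Fact sd_mulA : associative sd_mul.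
Proof.
move=> [k l] [k' l'] [k'' l'']; congr SDPair; rewrite /= ?mulgA //.
by rewrite !gmulfM /= mulgA.
Qed.
Fact sd_mul1 : left_id sd_one sd_mul.
Proof. by case=> k l; rewrite /sd_mul /= gmulf1 !mul1g. Qed.
Fact sd_mulr1 : right_id sd_one sd_mul.
Proof. by case=> k l; rewrite /sd_mul /= gmulf1 !mulg1. Qed.
Fact sd_mulV : left_inverse sd_one sd_inv sd_mul.
Proof. by case=> k l; congr SDPair; rewrite /= -?gmulfM mulVg ?gmulf1. Qed.
Fact sd_mulrV : right_inverse sd_one sd_inv sd_mul.
Proof.
by case=> k l; congr SDPair; rewrite /= -?autME -?gmulfM mulgV ?gmulf1 ?mulgV.
Qed.

HB.instance Definition _ :=
  isGroup.Build sdp sd_mulA sd_mul1 sd_mulr1 sd_mulV sd_mulrV.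

End SemidirectProduct.

(* A group identified with a common subgroup M of K and L, through the
   injections am_l and am_r, with M normal in L and, for k in K, l in L and m in
   M, psi l m = l * m * l^-1 (am_conj) and psi m k = m * k * m^-1 (am_act). *)
Record amalgam (K L : groupType) (psi : {hom L -> aut K}) := Amalgam {
  am_group :> groupType;
  am_l : {hom am_group -> K};
  am_r : {hom am_group -> L};
  am_l_inj : injective am_l;
  am_r_inj : injective am_r;
  am_normal : forall (l : L) (m : am_group),
    exists m', am_r m' = l * am_r m * l^-1;
  am_conj : forall (l : L) (m m' : am_group),
    am_r m' = l * am_r m * l^-1 -> psi l (am_l m) = am_l m';
  am_act : forall (m : am_group) (k : K),
    psi (am_r m) k = am_l m * k * (am_l m)^-1
}.

Arguments am_l {K L psi a}.
Arguments am_r {K L psi a}.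

Section AmalgamatedProduct.
Variables (K L : groupType) (psi : {hom L -> aut K}) (M : amalgam psi).

Definition mu_elt (m : M) : sdprod psi := SDPair psi (am_l m)^-1 (am_r m).

Definition mu : {pred sdprod psi} := fun p => `[< exists m : M, p = mu_elt m >].

Lemma muP p : reflect (exists m : M, p = mu_elt m) (p \in mu).
Proof. exact: asboolP. Qed.

Lemma mu_elt_morphism : monoid.monoid_morphism mu_elt.
Proof.
split=> [|m m']; rewrite /mu_elt; first by rewrite !gmulf1 invg1.
congr SDPair; rewrite /= ?gmulfM // am_act !mulgA mulVg mul1g.
by rewrite invgM.
Qed.

Fact mu1 : 1 \in mu.
Proof. by apply/muP; exists 1; rewrite mu_elt_morphism. Qed.
Fact muM : mulg_closed mu.
Proof.
move=> _ _ /muP[m ->] /muP[m' ->]; apply/muP; exists (m * m').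
by rewrite mu_elt_morphism.
Qed.
Fact muV : invg_closed mu.
Proof.
move=> _ /muP[m ->]; apply/muP; exists m^-1.
by apply: mulg1_eq; rewrite -mu_elt_morphism mulgV mu_elt_morphism.
Qed.
Fact muJ p q : p \in mu -> p ^ q \in mu.
Proof.
move=> /muP[m ->]; rewrite -[q]invgK; move: q^-1 => {q}[k l].
have [m' m'E] := am_normal l m.
apply/muP; exists m'; apply: (mulIg (SDPair psi k l)).
rewrite conjgE invgK -!mulgA mulVg mulg1.
congr SDPair; rewrite /= ?m'E ?mulgVK //.
have -> : psi l (am_l m)^-1 = (am_l m')^-1.
  by rewrite -(am_conj m'E); apply: gmulfV.
by rewrite -m'E am_act !mulgA mulVg mul1g.
Qed.

HB.instance Definition _ := isMulClosed.Build (sdprod psi) mu muM.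
HB.instance Definition _ := isMul1Closed.Build (sdprod psi) mu mu1.
HB.instance Definition _ := isInvClosed.Build (sdprod psi) mu muV.
HB.instance Definition _ := isNormal.Build (sdprod psi) mu muJ.

Definition amalgamated_sdprod : groupType := quotient mu.

Definition amalgamated_pair (k : K) (l : L) : amalgamated_sdprod :=
  cls mu (SDPair psi k l).

End AmalgamatedProduct.
Arguments amalgamated_pair {K L psi} M.

Section FreeGroup.
Variable X : choiceType.

(* The letter (x, false) stands for x and (x, true) for x^-1. *)
Definition letter : Type := X * bool.
HB.instance Definition _ := Choice.on letter.

Implicit Types (l m : letter) (w z : seq letter).

Definition flip l : letter := (l.1, ~~ l.2).

Definition reduced w := sorted (fun l m => m != flip l) w.

Definition push l w :=
  if w is m :: w' then if m == flip l then w' else l :: w else [:: l].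

Definition reduce w := foldr push [::] w.

Lemma flipK : involutive flip.
Proof. by case=> x b; rewrite /flip negbK. Qed.

Lemma push_reduced l w : reduced w -> reduced (push l w).
Proof.
case: w => [|m w] //= mw; case: eqP => [_|/eqP ml /=]; last by rewrite ml.
exact: path_sorted mw.
Qed.

Lemma reduce_reduced w : reduced (reduce w).
Proof. by elim: w => //= l w; apply: push_reduced. Qed.

Lemma reduce_id w : reduced w -> reduce w = w.
Proof.
elim: w => //= l w IHw lw; rewrite IHw; last exact: path_sorted lw.
by case: w lw {IHw} => //= m w /andP[/negPf->].
Qed.

Lemma pushK l w : reduced w -> push (flip l) (push l w) = w.
Proof.
case: w => [|m w] /= mw; first by rewrite flipK eqxx.
case: (m =P flip l) => [ml|_]; last by rewrite /= flipK eqxx.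
by case: w mw => [|m' w] /=; rewrite ml // => /andP[/negPf->].
Qed.

Lemma foldr_push_reduced w z : reduced z -> reduced (foldr push z w).
Proof. by move=> rz; elim: w => //= l w; apply: push_reduced. Qed.

Lemma foldr_push l w z :
  reduced z -> foldr push z (push l w) = push l (foldr push z w).
Proof.
move=> rz; case: w => //= m w; case: eqP => //= ->.
by rewrite -{1}[l]flipK pushK // foldr_push_reduced.
Qed.

Lemma foldr_reduce w z : reduced z -> foldr push z (reduce w) = foldr push z w.
Proof. by move=> rz; elim: w => //= l w <-; rewrite foldr_push. Qed.

Record freeGroup := FreeGroup { word :> seq letter; wordP : reduced word }.

HB.instance Definition _ := [isSub for word].
HB.instance Definition _ := [Choice of freeGroup by <:].

Definition fg_one : freeGroup := @FreeGroup [::] isT.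
Definition fg_mul (x y : freeGroup) : freeGroup :=
  FreeGroup (reduce_reduced (word x ++ word y)).
Definition fg_inv (x : freeGroup) : freeGroup :=
  FreeGroup (reduce_reduced (rev (map flip (word x)))).

Lemma reduce_cat w z : reduce (w ++ z) = foldr push (reduce z) w.
Proof. by rewrite /reduce foldr_cat. Qed.

Lemma reduce_catl w z : reduce (reduce w ++ z) = reduce (w ++ z).
Proof. by rewrite !reduce_cat foldr_reduce ?reduce_reduced. Qed.
Lemma reduce_catr w z : reduce (w ++ reduce z) = reduce (w ++ z).
Proof. by rewrite !reduce_cat reduce_id ?reduce_reduced. Qed.

Lemma reduce_flip w : reduce (rev (map flip w) ++ w) = [::].
Proof.
elim: w => //= l w IHw.
rewrite rev_cons cat_rcons reduce_cat /= pushK ?reduce_reduced //.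
by rewrite -reduce_cat.
Qed.

Fact fg_mulA : associative fg_mul.
Proof.
by move=> x y z; apply: val_inj; rewrite /= reduce_catl reduce_catr catA.
Qed.
Fact fg_mul1 : left_id fg_one fg_mul.
Proof. by move=> x; apply: val_inj; rewrite /= reduce_id // wordP. Qed.
Fact fg_mulr1 : right_id fg_one fg_mul.
Proof. by move=> x; apply: val_inj; rewrite /= cats0 reduce_id // wordP. Qed.
Fact fg_mulV : left_inverse fg_one fg_inv fg_mul.
Proof. by move=> x; apply: val_inj; rewrite /= reduce_catl reduce_flip. Qed.
Fact fg_mulrV : right_inverse fg_one fg_inv fg_mul.
Proof.
move=> x; apply: val_inj; rewrite /= reduce_catr.
have := reduce_flip (rev (map flip (word x))).
by rewrite map_rev revK (mapK flipK).
Qed.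

HB.instance Definition _ :=
  isGroup.Build freeGroup fg_mulA fg_mul1 fg_mulr1 fg_mulV fg_mulrV.

Definition gen (x : X) : freeGroup := @FreeGroup [:: (x, false)] isT.

Section Lift.
Variables (G : groupType) (g : X -> G).

Definition letter_val l : G := if l.2 then (g l.1)^-1 else g l.1.
Definition word_val w : G := \prod_(l <- w) letter_val l.
Definition free_lift (x : freeGroup) : G := word_val (word x).

Lemma letter_val_flip l : letter_val (flip l) = (letter_val l)^-1.
Proof. by case: l => x [] //=; rewrite /letter_val /= invgK. Qed.

Lemma word_val_push l w : word_val (push l w) = letter_val l * word_val w.
Proof.
rewrite /word_val; case: w => [|m w] /=; first by rewrite big_seq1 big_nil mulg1.
case: eqP => [->|_]; rewrite !big_cons //.
by rewrite letter_val_flip mulVKg.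
Qed.

Lemma word_val_reduce w : word_val (reduce w) = word_val w.
Proof.
by elim: w => //= l w IHw; rewrite word_val_push IHw /word_val big_cons.
Qed.

Fact free_lift_morphism : monoid.monoid_morphism free_lift.
Proof.
split=> [|x y]; first by rewrite /free_lift /word_val big_nil.
by rewrite /free_lift /= word_val_reduce /word_val big_cat.
Qed.
HB.instance Definition _ := isUMagmaMorphism.Build _ _ free_lift free_lift_morphism.

Lemma free_liftM x y : free_lift (x * y) = free_lift x * free_lift y.
Proof. exact: gmulfM. Qed.
Lemma free_liftV x : free_lift x^-1 = (free_lift x)^-1.
Proof. exact: gmulfV. Qed.
Lemma free_lift_gen x : free_lift (gen x) = g x.
Proof. by rewrite /free_lift /word_val big_seq1. Qed.

End Lift.

Lemma word_genE (x : freeGroup) : free_lift gen x = x.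
Proof.
have rE w : \prod_(l <- w) letter_val gen l = FreeGroup (reduce_reduced w).
  elim: w => [|l w IHw]; first by rewrite big_nil; apply: val_inj.
  rewrite big_cons IHw; apply: val_inj; rewrite /= reduce_catr.
  by case: l => y [].
by rewrite /free_lift /word_val rE; apply: val_inj; rewrite /= reduce_id // wordP.
Qed.

Lemma hom_ext (G : groupType) (f f' : {hom freeGroup -> G}) :
  (forall x, f (gen x) = f' (gen x)) -> f =1 f'.
Proof.
move=> ff' x; rewrite -(word_genE x) /free_lift /word_val !gmulf_prod.
apply: eq_bigr => l _; rewrite /letter_val.
by case: l.2; rewrite ?gmulfV ff'.
Qed.

End FreeGroup.

(* The library's 'GL_n[R] requires a finite ring R. *)
Section GeneralLinear.
Variables (n : nat) (R : comUnitRingType).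
Local Open Scope ring_scope.

Record GL := MkGL { GL_mx :> 'M[R]_n; GL_unit : GL_mx \in unitmx }.

HB.instance Definition _ := [isSub for GL_mx].
HB.instance Definition _ := [Choice of GL by <:].

Fact GL_mul_unit (A B : GL) : GL_mx A *m GL_mx B \in unitmx.
Proof. by rewrite unitmx_mul !GL_unit. Qed.
Fact GL_inv_unit (A : GL) : invmx A \in unitmx.
Proof. by rewrite unitmx_inv GL_unit. Qed.

Definition GL_one : GL := MkGL (unitmx1 R n).
Definition GL_mul (A B : GL) : GL := MkGL (GL_mul_unit A B).
Definition GL_inv (A : GL) : GL := MkGL (GL_inv_unit A).

Fact GL_mulA : associative GL_mul.
Proof. by move=> A B C; apply: val_inj; rewrite /= mulmxA. Qed.
Fact GL_mul1 : left_id GL_one GL_mul.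
Proof. by move=> A; apply: val_inj; rewrite /= mul1mx. Qed.
Fact GL_mulr1 : right_id GL_one GL_mul.
Proof. by move=> A; apply: val_inj; rewrite /= mulmx1. Qed.
Fact GL_mulV : left_inverse GL_one GL_inv GL_mul.
Proof. by move=> A; apply: val_inj; rewrite /= mulVmx ?GL_unit. Qed.
Fact GL_mulrV : right_inverse GL_one GL_inv GL_mul.
Proof. by move=> A; apply: val_inj; rewrite /= mulmxV ?GL_unit. Qed.

HB.instance Definition _ :=
  isGroup.Build GL GL_mulA GL_mul1 GL_mulr1 GL_mulV GL_mulrV.

Lemma GL_mxM (A B : GL) : GL_mx (A * B)%g = GL_mx A *m GL_mx B.
Proof. by []. Qed.

Definition SL : {pred GL} := fun A => \det (GL_mx A) == 1.

Fact SL1 : 1%g \in SL.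
Proof. by rewrite unfold_in det1. Qed.
Fact SLM : mulg_closed SL.
Proof.
by move=> A B /eqP dA /eqP dB; rewrite unfold_in det_mulmx dA dB mul1r.
Qed.
Fact SLV : invg_closed SL.
Proof. by move=> A /eqP dA; rewrite unfold_in det_inv dA invr1. Qed.

HB.instance Definition _ := isMulClosed.Build GL SL SLM.
HB.instance Definition _ := isMul1Closed.Build GL SL SL1.
HB.instance Definition _ := isInvClosed.Build GL SL SLV.

End GeneralLinear.
Arguments SL : clear implicits.

Notation F2 := (freeGroup 'I_2).
Definition u : F2 := gen ord0.
Definition v : F2 := gen ord_max.

Lemma ord2P (P : 'I_2 -> Prop) : P ord0 -> P ord_max -> forall i, P i.
Proof.
move=> P0 P1 i; case: (unliftP ord0 i) => [j ->|-> //].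
by have -> : lift ord0 j = ord_max by apply: val_inj; rewrite /= ord1.
Qed.

Definition gen2 (G : Type) (x y : G) (i : 'I_2) : G :=
  if i == ord0 then x else y.

Section Abelianization.
Local Open Scope ring_scope.

Definition letter_exp (i : 'I_2) (l : letter 'I_2) : int :=
  if l.1 == i then (-1) ^+ l.2 else 0.

(* The exponent sums of the two generators: the abelianization F2 -> Z^2 *)
Definition abelianize (x : F2) : 'cV[int]_2 :=
  \col_i \sum_(l <- word x) letter_exp i l.

Lemma letter_exp_flip i l : letter_exp i (flip l) = - letter_exp i l.
Proof.
by case: l => x []; rewrite /letter_exp /=; case: eqP; rewrite ?oppr0 ?opprK.
Qed.

Lemma sum_exp_reduce i (w : seq (letter 'I_2)) :
  \sum_(l <- reduce w) letter_exp i l = \sum_(l <- w) letter_exp i l.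
Proof.
elim: w => //= l w IHw; rewrite [RHS]big_cons -IHw.
case: (reduce w) => [|m w'] /=; first by rewrite !big_cons.
case: eqP => [->|_]; last by rewrite big_cons.
by rewrite big_cons letter_exp_flip addNKr.
Qed.

Lemma abelianizeM (x y : F2) :
  abelianize (x * y)%g = abelianize x + abelianize y.
Proof.
by apply/colP => i; rewrite !mxE /= sum_exp_reduce big_cat.
Qed.

Lemma abelianize1 : abelianize 1%g = 0.
Proof. by apply/colP => i; rewrite !mxE /= big_nil. Qed.

Lemma abelianizeV (x : F2) : abelianize x^-1%g = - abelianize x.
Proof. by apply/eqP; rewrite -addr_eq0 -abelianizeM mulVg abelianize1. Qed.

Lemma abelianize_gen i : abelianize (gen i) = delta_mx i 0.
Proof.
apply/colP => j; rewrite !mxE /= big_seq1 /letter_exp /= eqxx andbT eq_sym.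
by case: eqP.
Qed.

(* Acts on column vectors: the j-th column is the class of f (gen j). *)
Definition rho_mx (f : {hom F2 -> F2}) : 'M[int]_2 :=
  \matrix_(i, j) abelianize (f (gen j)) i 0.

Lemma rho_mxE (f : {hom F2 -> F2}) x :
  abelianize (f x) = rho_mx f *m abelianize x.
Proof.
rewrite -(word_genE x) /free_lift /word_val; elim: (word x) => [|l w IHw].
  by rewrite big_nil gmulf1 abelianize1 mulmx0.
rewrite big_cons gmulfM !abelianizeM mulmxDr IHw; congr (_ + _).
have fg j : abelianize (f (gen j)) = rho_mx f *m abelianize (gen j).
  by apply/colP => i; rewrite abelianize_gen -colE !mxE.
case: l => j []; rewrite /letter_val /= ?fg //.
by rewrite gmulfV !abelianizeV fg mulmxN.
Qed.

Lemma rho_mxM (f g : {hom F2 -> F2}) : rho_mx (f \o g) = rho_mx f *m rho_mx g.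
Proof.
apply/matrixP => i j; rewrite mxE [LHS]/= rho_mxE !mxE.
by apply: eq_bigr => k _; rewrite !mxE.
Qed.

Lemma rho_mx1 : rho_mx idfun = 1%:M.
Proof. by apply/matrixP => i j; rewrite mxE /= abelianize_gen !mxE andbT. Qed.

Fact rho_unit (f : aut F2) : rho_mx f \in unitmx.
Proof.
have ff' : rho_mx f *m rho_mx (f^-1)%g = 1%:M.
  rewrite -rho_mxM -rho_mx1; apply/matrixP => i j; rewrite !mxE.
  by rewrite /= (aut_invK f).
by have [] := mulmx1_unit ff'.
Qed.

Definition rho (f : aut F2) : GL 2 int := MkGL (rho_unit f).

Fact rho_morphism : monoid.monoid_morphism rho.
Proof.
split=> [|f g]; apply: val_inj; [exact: rho_mx1 | exact: rho_mxM].
Qed.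
HB.instance Definition _ := isUMagmaMorphism.Build _ _ rho rho_morphism.

End Abelianization.

Definition direct : {pred aut F2} := fun f => rho f \in SL 2 int.

Fact direct1 : 1 \in direct.
Proof. by rewrite unfold_in gmulf1 gpred1. Qed.
Fact directM : mulg_closed direct.
Proof. by move=> f g df dg; rewrite unfold_in gmulfM gpredM. Qed.
Fact directV : invg_closed direct.
Proof. by move=> f df; rewrite unfold_in gmulfV gpredV. Qed.

HB.instance Definition _ := isMulClosed.Build (aut F2) direct directM.
HB.instance Definition _ := isMul1Closed.Build (aut F2) direct direct1.
HB.instance Definition _ := isInvClosed.Build (aut F2) direct directV.

Notation "Aut^+" := (subgroup direct).

Definition alpha_hom : {hom F2 -> F2} := free_lift (gen2 u (u^-1 * v)).
Definition alpha_inv_hom : {hom F2 -> F2} := free_lift (gen2 u (u * v)).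
Definition beta_hom : {hom F2 -> F2} := free_lift (gen2 (v * u) v).
Definition beta_inv_hom : {hom F2 -> F2} := free_lift (gen2 (v^-1 * u) v).

Lemma gen2_u (x y : F2) : free_lift (gen2 x y) u = x.
Proof. exact: free_lift_gen. Qed.
Lemma gen2_v (x y : F2) : free_lift (gen2 x y) v = y.
Proof. exact: free_lift_gen. Qed.

Definition gen2E := (gen2_u, gen2_v).

Lemma F2_ext (G : groupType) (f g : {hom F2 -> G}) :
  f u = g u -> f v = g v -> f =1 g.
Proof. by move=> fu fv; apply: hom_ext; apply: ord2P. Qed.

Fact alphaK : cancel alpha_hom alpha_inv_hom.
Proof.
by apply: (@F2_ext _ (alpha_inv_hom \o alpha_hom) idfun);
  rewrite /= ?gen2E // !(free_liftM, free_liftV, gen2E) ?mulKg ?mulVKg.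
Qed.
Fact alphaVK : cancel alpha_inv_hom alpha_hom.
Proof.
by apply: (@F2_ext _ (alpha_hom \o alpha_inv_hom) idfun);
  rewrite /= ?gen2E // !(free_liftM, free_liftV, gen2E) ?mulKg ?mulVKg.
Qed.
Fact betaK : cancel beta_hom beta_inv_hom.
Proof.
by apply: (@F2_ext _ (beta_inv_hom \o beta_hom) idfun);
  rewrite /= ?gen2E // !(free_liftM, free_liftV, gen2E) ?mulKg ?mulVKg.
Qed.
Fact betaVK : cancel beta_inv_hom beta_hom.
Proof.
by apply: (@F2_ext _ (beta_hom \o beta_inv_hom) idfun);
  rewrite /= ?gen2E // !(free_liftM, free_liftV, gen2E) ?mulKg ?mulVKg.
Qed.

Fact hom_monoid_morphism (G H : groupType) (f : {hom G -> H}) :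
  monoid.monoid_morphism f.
Proof. by split; [exact: gmulf1 | exact: gmulfM]. Qed.

Definition alpha : aut F2 := Aut (hom_monoid_morphism alpha_hom) alphaK alphaVK.
Definition beta : aut F2 := Aut (hom_monoid_morphism beta_hom) betaK betaVK.

Lemma alpha_u : alpha u = u. Proof. exact: gen2_u. Qed.
Lemma alpha_v : alpha v = u^-1 * v. Proof. exact: gen2_v. Qed.
Lemma beta_u : beta u = v * u. Proof. exact: gen2_u. Qed.
Lemma beta_v : beta v = v. Proof. exact: gen2_v. Qed.

Definition braid_relator : {pred freeGroup 'I_2} :=
  let a := gen ord0 in let b := gen ord_max in
  pred1 ((a * b * a) / (b * a * b)).

Definition B3 : groupType := quotient (normal_closure braid_relator).

Definition a : B3 := cls (normal_closure braid_relator) (gen ord0).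
Definition b : B3 := cls (normal_closure braid_relator) (gen ord_max).
Definition s : B3 := a * b * a.

Lemma autM (G : groupType) (f : aut G) x y : f (x * y) = f x * f y.
Proof. exact: gmulfM. Qed.
Lemma autV (G : groupType) (f : aut G) x : f x^-1 = (f x)^-1.
Proof. exact: gmulfV. Qed.

Definition alpha_betaE := (alpha_u, alpha_v, beta_u, beta_v).

Fact sigma_u : (alpha * beta * alpha) u = u^-1 * v * u.
Proof. by rewrite !autME !(autM, autV, alpha_betaE). Qed.
Fact sigma_v : (alpha * beta * alpha) v = u^-1.
Proof. by rewrite !autME !(autM, autV, alpha_betaE) !gnorm. Qed.

Lemma alpha_beta_braid : alpha * beta * alpha = beta * alpha * beta.
Proof.
have tau_u : (beta * alpha * beta) u = u^-1 * v * u.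
  by rewrite !autME !(autM, autV, alpha_betaE) !gnorm.
have tau_v : (beta * alpha * beta) v = u^-1.
  by rewrite !autME !(autM, autV, alpha_betaE) !gnorm.
apply: aut_eqP; apply: F2_ext.
  by transitivity (u^-1 * v * u); [exact: sigma_u | exact/esym/tau_u].
by transitivity u^-1; [exact: sigma_v | exact/esym/tau_v].
Qed.

Definition braid_aut_free : {hom freeGroup 'I_2 -> aut F2} :=
  free_lift (gen2 alpha beta).

Fact braid_aut_free_kernel :
  {subset normal_closure braid_relator <= kernel braid_aut_free}.
Proof.
move=> x /normal_closureP; apply => _ /eqP ->; apply/eqP.
rewrite /= !(free_liftM, free_liftV) !free_lift_gen.
by apply/eqP; rewrite divg_eq1; apply/eqP; exact: alpha_beta_braid.
Qed.

Fact braid_aut_kernelE x : x \in normal_closure braid_relator -> braid_aut_free x = 1.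
Proof. by move/braid_aut_free_kernel/eqP. Qed.

Definition braid_aut : {hom B3 -> aut F2} := quotient_lift braid_aut_kernelE.

Lemma braid_aut_a : braid_aut a = alpha.
Proof. by rewrite [LHS]quotient_liftE; exact: free_lift_gen. Qed.
Lemma braid_aut_b : braid_aut b = beta.
Proof. by rewrite [LHS]quotient_liftE; exact: free_lift_gen. Qed.

Lemma braid_rel : a * b * a = b * a * b.
Proof.
pose N := normal_closure braid_relator; pose r (x y : freeGroup 'I_2) := x * y * x.
suff /clsP : 1^-1 * (r (gen ord0) (gen ord_max) / r (gen ord_max) (gen ord0)) \in N.
  by rewrite gmulfF !gmulfM gmulf1 => /esym/divg1_eq.
rewrite invg1 mul1g; apply/normal_closureP => M; apply; exact: eqxx.
Qed.

Lemma s2_central x : commute (s ^+ 2) x.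
Proof.
have sa : s * a = b * s by rewrite {1}/s braid_rel /s !mulgA.
have sb : s * b = a * s by rewrite [in RHS]/s braid_rel /s !mulgA.
have s2a : (s ^+ 2) * a = a * (s ^+ 2) by rewrite expg2 -mulgA sa mulgA sb -mulgA.
have s2b : (s ^+ 2) * b = b * (s ^+ 2) by rewrite expg2 -mulgA sb mulgA sa -mulgA.
pose N := normal_closure braid_relator.
have /hom_ext E : forall i, (inn (s ^+ 2) \o cls N) (gen i) = cls N (gen i).
  by apply: ord2P => /=; apply: (canLR (mulgK _)); [exact: s2a | exact: s2b].
have := E (cls_repr x); rewrite /= clsK => xE.
by rewrite /commute -{2}xE mulgVK.
Qed.

Lemma braid_aut_s4 : braid_aut (s ^+ 4) = inn [~ u, v].
Proof.
have iM := (hom_monoid_morphism braid_aut).2.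
transitivity (braid_aut s ^+ 4); first exact: gmulfXn.
rewrite /s !iM braid_aut_a braid_aut_b.
set sg := alpha * beta * alpha.
have E x : (sg ^+ 4) x = sg (sg (sg (sg x))) by [].
have su : sg u = u^-1 * v * u by exact: sigma_u.
have sv : sg v = u^-1 by exact: sigma_v.
apply: aut_eqP; apply: F2_ext; rewrite [LHS]E.
  by rewrite !(autM, autV, su, sv); apply: val_inj; vm_compute.
by rewrite !(autM, autV, su, sv); apply: val_inj; vm_compute.
Qed.

Definition Y : groupType := subgroup (cyclic_subgroup (s ^+ 4)).

Definition psi : {hom B3 -> aut (Int F2)} := conj_on (inner F2) \o braid_aut.

Fact braid_aut_Y x : x \in cyclic_subgroup (s ^+ 4) -> braid_aut x \in inner F2.
Proof.
have s4 : braid_aut (s ^+ 4) \in inner F2.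
  by apply/innerP; exists [~ u, v]; exact: braid_aut_s4.
case/cyclic_subgroupP => n [] ->.
  by rewrite gmulfXn gpredXn.
by rewrite gmulfXVn gpredXNn.
Qed.

(* By braid_aut_s4, this is the identification s^4 |-> inn [~ u, v]. *)
Definition Y_Int : {hom Y -> Int F2} := restrict braid_aut_Y.
Definition Y_B3 : {hom Y -> B3} := val.

(* u and v act on the line by x |-> 2 x and x |-> x + 1; then [~ u, v] is a
   nontrivial translation, and no nontrivial translation commutes with u. *)
Section AffineRepresentation.
Local Open Scope ring_scope.

Definition aff (p q : rat) : 'M[rat]_2 :=
  \matrix_(i, j) if i == ord0 then (if j == ord0 then p else q)
                 else (if j == ord0 then 0 else 1).

Lemma affM p q p' q' : aff p q *m aff p' q' = aff (p * p') (p * q' + q).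
Proof.
apply/matrixP; apply: ord2P; apply: ord2P; rewrite !mxE !big_ord_recl big_ord0 !mxE /=;
  by rewrite ?(mulr0, mulr1, mul0r, addr0, add0r).
Qed.

Lemma aff1 : aff 1 0 = 1%:M.
Proof. by apply/matrixP; apply: ord2P; apply: ord2P; rewrite !mxE. Qed.

Lemma aff_inj p q p' q' : aff p q = aff p' q' -> q = q'.
Proof. by move/matrixP/(_ ord0 ord_max); rewrite !mxE. Qed.

Fact aff2_unit : aff 2 0 \in unitmx.
Proof.
have : aff 2 0 *m aff (1 / 2) 0 = 1%:M by rewrite affM -aff1; congr aff.
by case/mulmx1_unit.
Qed.
Fact affT_unit : aff 1 1 \in unitmx.
Proof.
have : aff 1 1 *m aff 1 (-1) = 1%:M by rewrite affM -aff1; congr aff.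
by case/mulmx1_unit.
Qed.

Definition aff_rep : {hom F2 -> GL 2 rat} :=
  free_lift (gen2 (MkGL aff2_unit) (MkGL affT_unit)).

Fact affC_unit : aff 1 (1 / 2) \in unitmx.
Proof.
have : aff 1 (1 / 2) *m aff 1 (- (1 / 2)) = 1%:M by rewrite affM -aff1; congr aff.
by case/mulmx1_unit.
Qed.

Lemma commutator_power_noncentral n :
  commute ([~ u, v] ^+ n)%g u -> n = 0%N.
Proof.
pose C := MkGL affC_unit.
have ru : aff_rep u = MkGL aff2_unit by exact: free_lift_gen.
have rv : aff_rep v = MkGL affT_unit by exact: free_lift_gen.
have rM := (hom_monoid_morphism aff_rep).2.
have rC : aff_rep [~ u, v]%g = C.
  apply: (@mulgI _ (aff_rep (v * u)%g)).
  rewrite -rM -commgC !rM ru rv; apply: val_inj; rewrite /= !affM.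
  by congr aff.
have CX m : GL_mx (C ^+ m)%g = aff 1 (m%:R / 2).
  elim: m => [|m IHm]; first by rewrite mul0r aff1.
  rewrite expgS GL_mxM IHm affM mulr1 mul1r -mulrDl; congr (aff _ (_ / _)).
  by rewrite -natr1.
move=> /(congr1 (fun x => GL_mx (aff_rep x))).
have rX : aff_rep ([~ u, v] ^+ n)%g = (C ^+ n)%g.
  by rewrite -rC; exact: gmulfXn.
rewrite !rM rX ru !GL_mxM CX !affM => /aff_inj.
rewrite mulr0 add0r addr0 => n2.
have /eqP : n%:R / 2 = 0 :> rat.
  by apply: (@addrI _ (n%:R / 2)); rewrite addr0 [RHS]n2 (mulr_natl _ 2) mulr2n.
by rewrite mulf_eq0 invr_eq0 orbF Num.Theory.pnatr_eq0 => /eqP.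
Qed.

End AffineRepresentation.

Lemma inn_commutator_power n : inn ([~ u, v] ^+ n) = 1 -> n = 0.
Proof.
move=> /(congr1 (fun f : aut F2 => f u)) /= cu.
by apply: commutator_power_noncentral; exact: (canRL (mulgVK _) cu).
Qed.

Lemma Y_Int_inj : injective Y_Int.
Proof.
apply: gmulf_inj => y yE.
have {yE} : braid_aut (val y) = 1 by rewrite -[LHS]/(val (Y_Int y)) yE.
have iX n : braid_aut ((s ^+ 4) ^+ n) = inn ([~ u, v] ^+ n).
  transitivity (braid_aut (s ^+ 4) ^+ n); first exact: gmulfXn.
  by rewrite braid_aut_s4; apply/esym/gmulfXn.
move=> y1; apply: val_inj; move: y1.
case/cyclic_subgroupP: (valP y) => n [] ->.
  by rewrite iX => /inn_commutator_power ->.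
move=> yV; have : braid_aut ((s ^+ 4) ^+ n) = 1.
  by apply: invg_inj; rewrite invg1 -yV; apply/esym/gmulfV.
by rewrite iX => /inn_commutator_power ->; rewrite invg1.
Qed.

Lemma Y_central (l : B3) (y : Y) : l * Y_B3 y * l^-1 = Y_B3 y.
Proof.
have c4 : commute l (s ^+ 4).
  by rewrite (expgnA s 2 2); apply/commuteX/commute_sym/s2_central.
have -> : l * Y_B3 y = Y_B3 y * l; last exact: mulgK.
rewrite /Y_B3 /=; case/cyclic_subgroupP: (valP y) => n [] ->.
  exact/commuteX.
exact/commuteV/commuteX.
Qed.

Fact Y_normal (l : B3) (y : Y) : exists y', Y_B3 y' = l * Y_B3 y * l^-1.
Proof. by exists y; rewrite Y_central. Qed.

Fact Y_conj (l : B3) (y y' : Y) :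
  Y_B3 y' = l * Y_B3 y * l^-1 -> psi l (Y_Int y) = Y_Int y'.
Proof.
move=> y'E; apply: val_inj.
transitivity (braid_aut (Y_B3 y')); last by [].
rewrite y'E !(hom_monoid_morphism braid_aut).2.
by congr (_ * _ * _); apply/esym/gmulfV.
Qed.

Fact Y_act (y : Y) (h : Int F2) : psi (Y_B3 y) h = Y_Int y * h * (Y_Int y)^-1.
Proof. exact: val_inj. Qed.

Definition Y_amalgam : amalgam psi :=
  Amalgam Y_Int_inj val_inj Y_normal Y_conj Y_act.

(* Main.v *)
Require Import Defs.
Set Warnings "-notation-overridden,-ambiguous-paths".
From HB Require Import structures.
From mathcomp Require Import all_boot all_order all_algebra.
From mathcomp Require Import boolp.
From mathcomp Require Import ring zify.

(** The proof follows Nielsen, with the geometry of the Cayley tree expressed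
by word lengths and the lengths gp x y of common prefixes.

Composing an endomorphism psi with inner automorphisms on the left and with
braids on the right allows one to multiply the image of one generator by the
image of the other, and to move the base point of the tree. A surjective psi
for which |psi u| + |psi v| is minimal under these moves is Nielsen reduced
(minimal_nielsen_reduced), so that psi cannot shorten words (len_free_lift), and
then surjectivity forces psi u and psi v to be distinct generators up to
inversion. Hence every surjective endomorphism is an inner automorphism
composed with 1 or the exchange of u and v and then with a braid (nielsen);
the determinant decides between the two cases. This gives (i) and the equality
of Aut^+ with the product of Int and B3.

Since braids fix the commutator c = [~ u, v], direct automorphisms preserve it
up to conjugation. Conversely, suppose that phi sends c to a conjugate of c.
After a conjugation, c lies in the commutator subgroup of the image H of phi,
so the loop c in the Schreier graph of H crosses each edge equally often in
both directions. A loop reading u^-1 v^-1 u v can do so only if both generators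
are loops at the base vertex, that is, if H is the whole group
(commutator_image). The determinant of phi is then read off from the signed
area enclosed by c (commutator_det). An automorphism that fixes c is a braid up
to conjugation by an element commuting with c, that is, by a power of c
(commutator_centralizer), and inn c is the braid s^4.

What remains is the kernel of B3 -> SL(2, Z). Every braid is a product
t1 * w * t2 with t1, t2 powers of s and w a positive word in a^-1 and b
(normal_form_all). The matrix of w is nonnegative and its off-diagonal entries
grow with the length of w, while the powers of s are the four quarter turns. So
a braid with trivial matrix is a power of s, hence of s^4 (braid_mx_kernel).
This gives (iii), as s^4 acts by an inner automorphism, and it also gives the
injectivity in (ii). *)

Set Implicit Arguments.
Unset Strict Implicit.
Unset Printing Implicit Defensive.

Import GRing.Theory.
Local Open Scope group_scope.

(** * Word length and common prefixes in a free group *)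

Section LongestCommonPrefix.
Variable T : eqType.
Implicit Types s t r : seq T.

Fixpoint lcp s t : nat :=
  match s, t with
  | x :: s', y :: t' => if x == y then (lcp s' t').+1 else 0
  | _, _ => 0
  end.

Lemma lcp_sym s t : lcp s t = lcp t s.
Proof. by elim: s t => [|x s IHs] [|y t] //=; rewrite eq_sym IHs. Qed.

Lemma lcp_size s t : lcp s t <= size s.
Proof. by elim: s t => [|x s IHs] [|y t] //=; case: ifP => _ //; apply: IHs. Qed.

(** The Cayley graph of a free group is a tree; this is its 0-hyperbolicity. *)
Lemma lcp_hyperbolic s t r : minn (lcp s t) (lcp t r) <= lcp s r.
Proof.
elim: s t r => [|x s IHs] [|y t] [|z r] //=; rewrite ?minn0 ?min0n //.
case: (x =P y) => [->|_]; rewrite ?min0n //.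
by case: (y =P z) => [_|_]; rewrite ?minn0 // minnSS ltnS.
Qed.

Lemma lcp_nth x0 s t i : i < lcp s t -> nth x0 s i = nth x0 t i.
Proof.
elim: s t i => [|x s IHs] [|y t] //= i.
by case: (x =P y) => [->|//]; case: i => //= i; apply: IHs.
Qed.

Lemma lcp_take s k : lcp (take k s) s = minn k (size s).
Proof.
elim: s k => [|x s IHs] [|k] //=; rewrite ?min0n ?minn0 // eqxx.
by rewrite IHs minnSS.
Qed.

Lemma lcp_full s t : lcp s t = size s -> s = take (size s) t.
Proof.
elim: s t => [|x s IHs] [|y t] //=.
by case: eqP => // -> [/IHs <-].
Qed.

End LongestCommonPrefix.

Section Length.
Variable X : choiceType.
Local Notation F := (Group.sort (Defs_freeGroup__canonical__monoid_Group X)).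
Implicit Types (x y z : F) (s t : seq (letter X)).

Definition len x := size (word x).
(** The distance in the Cayley tree. *)
Definition dist x y := len (x^-1 * y).
(** The Gromov product at 1: the paths from 1 to x and to y share gp x y edges. *)
Definition gp x y := lcp (word x) (word y).

Lemma reduced_flip_rev s t :
    reduced s -> reduced t -> (forall l s' m t', s = l :: s' -> t = m :: t' -> l != m) ->
  reduced (rev (map (@flip X) s) ++ t).
Proof.
elim: s t => [|l s IHs] //= t rs rt st.
rewrite rev_cons cat_rcons; apply: IHs.
- exact: path_sorted rs.
- case: t rt st => [|m t] //= rt st; rewrite flipK eq_sym (st _ _ _ _ erefl erefl) //.
- by move=> l' s' m t' sE [<- _]; move: rs; rewrite sE /= => /andP[].
Qed.

(** In s^-1 * t exactly the common prefix of s and t cancels. *)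
Lemma reduce_flip_cat s t : reduced s -> reduced t ->
  size (reduce (rev (map (@flip X) s) ++ t)) + (lcp s t).*2 = size s + size t.
Proof.
elim: s t => [|l s IHs] t rs rt; first by rewrite reduce_id ?addn0.
have rs' : reduced s by exact: path_sorted rs.
case: t rt => [|m t] rt.
  rewrite reduce_id; last exact: reduced_flip_rev.
  by rewrite size_cat size_rev size_map !addn0.
rewrite [lcp _ _]/=; case: eqP => [lm|/eqP lm].
  rewrite -{}lm in rt *.
  have rt' : reduced t by exact: path_sorted rt.
  have step : reduce (rev (map (@flip X) (l :: s)) ++ l :: t) =
      reduce (rev (map (@flip X) s) ++ t).
    rewrite [map _ _]/= rev_cons cat_rcons !reduce_cat.
    have -> : reduce (flip l :: l :: t) = push (flip l) (reduce (l :: t)) by [].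
    by rewrite !reduce_id //= flipK eqxx.
  by rewrite step /= doubleS !addnS IHs // addSn.
rewrite reduce_id; first by rewrite size_cat size_rev size_map addn0.
by apply: reduced_flip_rev => // ? ? ? ? [<- _] [<- _].
Qed.

Lemma gpE x y : dist x y + (gp x y).*2 = len x + len y.
Proof.
by rewrite -reduce_flip_cat ?wordP // /dist /len /= reduce_catl.
Qed.

Lemma gpC x y : gp x y = gp y x. Proof. exact: lcp_sym. Qed.

Lemma gp_hyperbolic x y z : minn (gp x y) (gp y z) <= gp x z.
Proof. exact: lcp_hyperbolic. Qed.

Lemma gp_le x y : gp x y <= len x. Proof. exact: lcp_size. Qed.

Lemma len1 : len 1 = 0. Proof. by []. Qed.

Lemma len_eq0 x : len x = 0 -> x = 1.
Proof. by move/size0nil => x0; apply: val_inj. Qed.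

Lemma lenV x : len x^-1 = len x.
Proof. by have := gpE x 1; have := gp_le 1 x; rewrite /dist len1 gpC mulg1; lia. Qed.

Lemma lenM x y : len (x * y) + (gp x^-1 y).*2 = len x + len y.
Proof. by have := gpE x^-1 y; rewrite /dist invgK lenV. Qed.

Lemma lenM_le x y : len (x * y) <= len x + len y.
Proof. by have := lenM x y; lia. Qed.

(** In x * y the cancelled part is the overlap of x^-1 and y, and what is left of
x is its overlap with x * y. *)
Lemma gp_mulr x y : gp x (x * y) + gp x^-1 y = len x.
Proof.
have := lenM x y; have := gpE x (x * y); rewrite /dist mulKg.
have := gp_le x (x * y); have := gp_le x^-1 y; lia.
Qed.

(** An overlap of x and x^-1 of at least half the length would make the middle of
x either a letter equal to its own inverse or a cancelling pair. *)
Lemma gpV_half x : x != 1 -> (gp x x^-1).*2 < len x.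
Proof.
move=> x1; rewrite ltnNge; apply/negP => h.
have n0 : 0 < len x by rewrite lt0n; apply/eqP => /len_eq0/eqP; rewrite (negPf x1).
have [l0 _] : exists l : letter X, True by move: n0; rewrite /len; case: (word x) => // l; exists l.
have xV : word x^-1 = rev (map (@flip X) (word x)).
  rewrite /= reduce_id // -[rev _]cats0.
  by apply: reduced_flip_rev => //; exact: wordP.
have E i : i < gp x x^-1 -> nth l0 (word x) i = flip (nth l0 (word x) (len x - i.+1)).
  move=> ix; have il : i < len x by exact: leq_trans ix (gp_le _ _).
  rewrite (lcp_nth l0 ix) xV nth_rev ?size_map //.
  by rewrite (nth_map l0) // -/(len x); lia.
have nf (l : letter X) : l <> flip l by case: l => a [] [].
case: (boolP (odd (len x))) => o.
  apply: (nf (nth l0 (word x) (len x)./2)); rewrite {1}E; last by lia.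
  by congr (flip (nth _ _ _)); lia.
have := E ((len x)./2.-1); rewrite (_ : len x - _ = ((len x)./2.-1).+1); last by lia.
move=> E'; have {}E' : nth l0 (word x) (len x)./2.-1 = flip (nth l0 (word x) (len x)./2.-1.+1).
  by apply: E'; lia.
have /sortedP := wordP x => /(_ l0 (len x)./2.-1).
rewrite E' flipK eqxx => /(_ _)/negP; case=> //.
by rewrite -/(len x); lia.
Qed.

Lemma prefix_exists x k : k <= len x -> exists2 q, len q = k & gp q x = k.
Proof.
move=> kx; have rq : reduced (take k (word x)) by apply: take_sorted; exact: wordP.
exists (FreeGroup rq); first by rewrite /len /= size_takel.
by rewrite /gp /= lcp_take; apply/minn_idPl.
Qed.

End Length.

(** * Nielsen reduced families do not shorten words *)

Section NielsenReduced.
Variables (I X : choiceType) (g : I -> freeGroup X).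
Local Notation A := (letter_val g).

(** In a reduced product of the A l, cancellation on both sides cannot
eat up a factor. *)
Definition nielsen_reduced := forall l m n, m != l -> n != flip l ->
  gp (A l) (A m) + gp (A l)^-1 (A n) < len (A l).

Lemma flip_neq (l : letter I) : l != flip l.
Proof. by apply/eqP; case: l => i [] []. Qed.

Lemma gpxx (x : freeGroup X) : gp x x = len x.
Proof. by have := gpE x x; rewrite /dist mulVg len1; lia. Qed.

(** The product starts like its first factor A l, beyond the overlap of A l with any
other A m. When a factor is put in front, the overlap of its inverse with the
product is therefore its overlap with the first factor alone, which is at most
the overlap allowed by nielsen_reduced. *)
Lemma len_word_val l t : nielsen_reduced -> reduced (l :: t) ->
  (forall m, m != l -> gp (A l) (A m) < gp (A l) (word_val g (l :: t))) /\
  size t + gp (A l) (word_val g (l :: t)) <= len (word_val g (l :: t)).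
Proof.
move=> N; have valE l' t' : word_val g (l' :: t') = A l' * word_val g t'.
  by rewrite /word_val big_cons.
elim: t l => [|k t IHt] l rt; rewrite valE.
  rewrite /word_val big_nil mulg1 gpxx; split=> // m ml.
  by have := N l m l ml (flip_neq l); lia.
move: rt => /= /andP[kl rt]; have [gt le] := IHt k rt.
have := gp_mulr (A l) (word_val g (k :: t)).
have := lenM (A l) (word_val g (k :: t)).
move: (word_val g _) gt le => z gt le.
have := gt (flip l); rewrite eq_sym kl => /(_ isT).
rewrite letter_val_flip => lt lenE gpE'.
have := gp_hyperbolic (A l)^-1 z (A k); rewrite (gpC z) => hyp.
have := gpC (A k) (A l)^-1 => sym.
split=> [m ml|]; last by rewrite [size _]/=; lia.
by have := N l m k ml kl; lia.
Qed.

Lemma len_free_lift (x : freeGroup I) : nielsen_reduced ->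
  size (word x) <= len (free_lift g x).
Proof.
move=> N; rewrite /free_lift; case: (word x) (wordP x) => [|l t] //= rt.
have [gt le] := len_word_val N rt.
by have := gt (flip l); rewrite eq_sym flip_neq => /(_ isT); lia.
Qed.

End NielsenReduced.

(** * Moves on the images of the generators *)

Section HomRules.
Implicit Types (f : {hom F2 -> F2}) (p q : F2) (x y : B3).

Lemma homM f p q : f (p * q) = f p * f q. Proof. exact: gmulfM. Qed.
Lemma homV f p : f p^-1 = (f p)^-1. Proof. exact: gmulfV. Qed.
Lemma homR f p q : f [~ p, q] = [~ f p, f q]. Proof. exact: gmulfR. Qed.

Lemma innE p q : inn p q = p * q * p^-1. Proof. by []. Qed.
Lemma inn1 : inn (1 : F2) = 1. Proof. exact: gmulf1. Qed.
Lemma innM p q : inn (p * q) = inn p * inn q. Proof. exact: gmulfM. Qed.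
Lemma innV p : inn p^-1 = (inn p)^-1. Proof. exact: gmulfV. Qed.

Lemma braid_aut1 : braid_aut 1 = 1. Proof. exact: gmulf1. Qed.
Lemma braid_autM x y : braid_aut (x * y) = braid_aut x * braid_aut y.
Proof. exact: gmulfM. Qed.
Lemma braid_autV x : braid_aut x^-1 = (braid_aut x)^-1.
Proof. exact: gmulfV. Qed.

End HomRules.

(** Composing with inner automorphisms on the left and with braids on the right
is how length reduction is carried out: a braid changes one generator by a
multiple of the other, and an inner automorphism moves the base point. *)
Definition braid_equiv (psi chi : F2 -> F2) :=
  exists w x, psi =1 inn w \o chi \o braid_aut x.

Lemma braid_equiv_refl psi : braid_equiv psi psi.
Proof. by exists 1, 1 => x; rewrite inn1 braid_aut1. Qed.

Lemma braid_equiv_trans psi chi xi :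
  braid_equiv psi chi -> braid_equiv chi xi -> braid_equiv psi xi.
Proof.
move=> [w [x E]] [w' [x' E']]; exists (w * w'), (x' * x) => y.
by rewrite E [LHS]/= E' innM braid_autM.
Qed.

Section Moves.
Variable psi : {hom F2 -> F2}.
Local Notation A := (letter_val (fun i => psi (gen i))).

Lemma hom_letter l : psi (letter_val (@gen _) l) = A l.
Proof. by case: l => i []; rewrite /letter_val //= gmulfV. Qed.

Definition twist w x : {hom F2 -> F2} := inn w \o psi \o braid_aut x.

Lemma twist_equiv w x : braid_equiv psi (twist w x).
Proof.
exists w^-1, x^-1 => y.
transitivity ((inn w^-1 * inn w) (psi ((braid_aut x * braid_aut x^-1) y))) => //.
by rewrite -innM -braid_autM mulVg mulgV inn1 braid_aut1.
Qed.

Lemma twistE w x p : twist w x p = w * psi (braid_aut x p) * w^-1.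
Proof. by []. Qed.

(** The Nielsen move m |-> l^-1 m on the images of two letters. *)
Definition letter_move (l m : letter 'I_2) (psi' : {hom F2 -> F2}) :=
  letter_val (fun i => psi' (gen i)) l = A l /\
  letter_val (fun i => psi' (gen i)) m = (A l)^-1 * A m.

Lemma braid_aut_aV : braid_aut a^-1 = alpha^-1.
Proof. by rewrite braid_autV braid_aut_a. Qed.
Lemma braid_aut_bV : braid_aut b^-1 = beta^-1.
Proof. by rewrite braid_autV braid_aut_b. Qed.

Lemma alphaV_u : alpha^-1 u = u.
Proof. exact: gen2_u. Qed.
Lemma alphaV_v : alpha^-1 v = u * v.
Proof. exact: gen2_v. Qed.
Lemma betaV_u : beta^-1 u = v^-1 * u.
Proof. exact: gen2_u. Qed.
Lemma betaV_v : beta^-1 v = v.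
Proof. exact: gen2_v. Qed.

Definition moveE :=
  (twistE, braid_aut_a, braid_aut_aV, braid_aut_b, braid_aut_bV, alpha_betaE,
   (alphaV_u, alphaV_v, betaV_u, betaV_v), homM, homV).

(* The pair (U, V) is the one obtained from (psi u, psi v) by conjugating by w and
   acting by the braid x. *)
Local Ltac pair_move S w x U V :=
  let p := fresh "p" in let pu := fresh "pu" in let pv := fresh "pv" in
  case: (S w x U V); rewrite ?moveE ?gnorm // => p ? [pu pv]; exists p => //;
  rewrite /letter_move /letter_val /= pu pv -/u -/v ?gnorm.

(** The braids a and b and their inverses provide the multiplications on one side;
those on the other side follow by conjugation. *)
Lemma letter_move_exists l m : l.1 != m.1 ->
  exists2 psi' : {hom F2 -> F2}, braid_equiv psi psi' & letter_move l m psi'.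
Proof.
have S w x U V : w * psi (braid_aut x u) * w^-1 = U ->
    w * psi (braid_aut x v) * w^-1 = V ->
    exists2 psi' : {hom F2 -> F2}, braid_equiv psi psi' &
      psi' (gen ord0) = U /\ psi' (gen ord_max) = V.
  by move=> <- <-; exists (twist w x) => //; exact: twist_equiv.
case: l m => [i e] [j e']; rewrite [_.1]/= [in X in _ != X]/=.
move: i j; apply: ord2P; apply: ord2P => // _; case: e; case: e'.
- by pair_move S (psi u) a (psi u) (psi v / psi u).
- by pair_move S (1 : F2) a^-1 (psi u) (psi u * psi v).
- by pair_move S (psi u)^-1 a^-1 (psi u) (psi v * psi u).
- by pair_move S (1 : F2) a (psi u) ((psi u)^-1 * psi v).
- by pair_move S (psi v) b^-1 (psi u / psi v) (psi v).
- by pair_move S (1 : F2) b (psi v * psi u) (psi v).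
- by pair_move S (psi v)^-1 b (psi u * psi v) (psi v).
- by pair_move S (1 : F2) b^-1 ((psi v)^-1 * psi u) (psi v).
Qed.
End Moves.

(** * Pairs of minimal length are Nielsen reduced *)

Section HalfOverlap.
Variable X : choiceType.
Local Notation F := (Group.sort (Defs_freeGroup__canonical__monoid_Group X)).

(** Here x = p q^-1 and y = p z q^-1 with p and q of length h, so that
x^-1 y = q z q^-1: conjugating x and x^-1 y by q^-1 shortens the pair. This is
the only way in which a pair can fail to be Nielsen reduced although no single
multiplication shortens it. *)
Lemma half_overlap (x y : F) h :
  len x = h.*2 -> h.*2 <= len y -> gp x y = h -> gp x^-1 y^-1 = h ->
  exists q : F, len (q^-1 * x * q) <= len x /\
            len (q^-1 * (x^-1 * y) * q) + len x <= len y.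
Proof.
move=> lx ly gxy gxy'.
have [q lq gq] : exists2 q : F, len q = h & gp q x^-1 = h.
  by apply: prefix_exists; rewrite lenV; lia.
exists q; have lxq : len (x * q) = h by have := lenM x q; rewrite gpC; lia.
have gqy : gp q y^-1 = h.
  by have := gp_hyperbolic q x^-1 y^-1; have := gp_le q y^-1; lia.
have lyq : len (y * q) = len y - h by have := lenM y q; rewrite gpC; lia.
have gx : gp (x * q) x = h by have := gp_mulr x q; rewrite [gp x^-1 q]gpC [gp (_ * _) _]gpC; lia.
have gy : gp y (y * q) = len y - h by have := gp_mulr y q; rewrite [gp y^-1 q]gpC; lia.
have gxyq : h <= gp (x * q) (y * q).
  have := gp_hyperbolic (x * q) x (y * q); have := gp_hyperbolic x y (y * q).
  by lia.
have -> : q^-1 * x * q = q^-1 * (x * q) by rewrite mulgA.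
have -> : len (q^-1 * (x^-1 * y) * q) = dist (x * q) (y * q).
  by rewrite /dist invgM !mulgA.
have := lenM_le q^-1 (x * q); rewrite lenV lq lxq lx => le.
have := gpE (x * q) (y * q); rewrite lxq lyq => dxy.
by split; [apply: (leq_trans le); lia | lia].
Qed.

End HalfOverlap.

Definition total_len (psi : {hom F2 -> F2}) :=
  \sum_(i < 2) len (psi (gen i)).

Lemma letter_cases (l m : letter 'I_2) : l.1 = m.1 -> m = l \/ m = flip l.
Proof.
by case: l m => i e [j e'] /= ->; case: e e' => [] []; [left|right|right|left].
Qed.

Lemma total_len_letters (psi : {hom F2 -> F2}) (l m : letter 'I_2) : l.1 != m.1 ->
  total_len psi = len (letter_val (fun i => psi (gen i)) l)
            + len (letter_val (fun i => psi (gen i)) m).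
Proof.
have E k : len (letter_val (fun i => psi (gen i)) k) = len (psi (gen k.1)).
  by case: k => i []; rewrite /letter_val //= lenV.
rewrite !E /total_len; case: l m => [i e] [j e'] /=; move: i j.
by apply: ord2P; apply: ord2P => // _; rewrite !big_ord_recl big_ord0 addn0
  (_ : lift _ _ = ord_max) 1?addnC //; apply: val_inj.
Qed.

(** By minimality A l overlaps any A m with another generator in at most half of its
length, and by gpV_half it overlaps its inverse in less. So a violation needs two
overlaps of exactly one half, with a letter m on the left and with flip m on the
right, which is the situation of half_overlap. *)
Lemma minimal_nielsen_reduced (psi : {hom F2 -> F2}) :
  (forall i, psi (gen i) <> 1) ->
  (forall psi' : {hom F2 -> F2}, braid_equiv psi psi' -> total_len psi <= total_len psi') ->
  nielsen_reduced (fun i => psi (gen i)).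
Proof.
rewrite /nielsen_reduced; set A := letter_val _ => n1 min l m n ml nl.
have A1 k : A k != 1.
  by case: k => i []; rewrite /A /letter_val /= ?invg_eq1; apply/eqP.
have own k : (gp (A k) (A k)^-1).*2 < len (A k) by exact: gpV_half.
have half k j : k.1 != j.1 -> (gp (A k) (A j)).*2 <= len (A k).
  move=> kj; have [psi' /min le [Ek Ej]] := letter_move_exists psi kj.
  move: le; rewrite !(total_len_letters _ kj) Ek Ej.
  by have := gpE (A k) (A j); rewrite -/A -/(dist _ _); lia.
rewrite ltnNge; apply/negP => ge.
have AV k : A (flip k) = (A k)^-1 by exact: letter_val_flip.
have lm : l.1 != m.1.
  apply/negP => /eqP /letter_cases [E|E]; first by rewrite E eqxx in ml.
  have := own l; rewrite E AV in ge.
  have [ln|/negPn/eqP/letter_cases[E'|E']] := boolP (l.1 != n.1).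
  - have := half (flip l) n ln; rewrite AV lenV; lia.
  - by rewrite E' (gpC (A l)^-1) in ge; lia.
  - by rewrite E' eqxx in nl.
have ln : l.1 != n.1.
  apply/negP => /eqP /letter_cases [E|E]; last by rewrite E eqxx in nl.
  by have := own l; have := half l m lm; move: ge; rewrite E [gp _^-1 _]gpC; lia.
have h1 := half l m lm; have h2 := half (flip l) n ln.
rewrite AV lenV in h2.
have mn : n = flip m.
  have /letter_cases[E|//] : m.1 = n.1.
    case: (l) (m) (n) lm ln => [i ?] [j ?] [k ?] /=; move: i j k.
    by do 3! apply: ord2P.
  have := own l; have := gp_hyperbolic (A l) (A m) (A l)^-1.
  by rewrite E in ge h2; rewrite (gpC (A m)); lia.
rewrite mn AV in ge h2; pose h := gp (A l) (A m).
have h3 := half m l; rewrite eq_sym in h3.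
have := h3 lm; rewrite gpC => {}h3.
have [|||//|q [q1 q2]] := @half_overlap _ (A l) (A m) h; rewrite ?/h; try lia.
(* First m |-> l^-1 m, which keeps the total length, then conjugation by q^-1. *)
have [psi' eq' [El Em]] := letter_move_exists psi lm.
have twist_total : total_len (twist psi' q^-1 1) =
    len (q^-1 * A l * q) + len (q^-1 * ((A l)^-1 * A m) * q).
  rewrite (total_len_letters _ lm) -!hom_letter !twistE braid_aut1 !aut1E.
  by rewrite !hom_letter El Em invgK.
have := min _ (braid_equiv_trans eq' (twist_equiv psi' q^-1 1)).
rewrite twist_total (total_len_letters _ lm) -/A => le.
have : 0 < len (A l) by rewrite lt0n; apply/eqP => /len_eq0/eqP; rewrite (negPf (A1 l)).
by have := leq_add q1 q2; lia.
Qed.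

(** * Surjective endomorphisms of the free group of rank two *)

Lemma uv_noncommuting : ~ commute u v.
Proof.
move/commgP/eqP => c1; have := @inn_commutator_power 1.
by rewrite expg1 c1 inn1 => /(_ erefl).
Qed.

Lemma commute_hom (psi : {hom F2 -> F2}) z :
  commute z (psi u) -> commute z (psi v) -> forall p, commute z (psi p).
Proof.
move=> zu zv p; have E : inn z \o psi =1 psi.
  by apply: F2_ext; rewrite [LHS]/= ?zu ?zv mulgK.
by have := E p; rewrite /= => /(canRL (mulgVK _)).
Qed.

Lemma commuting_not_surjective (psi : {hom F2 -> F2}) :
  commute (psi u) (psi v) -> ~ (forall y, exists x, psi x = y).
Proof.
move=> uv sur; apply: uv_noncommuting.
have [[p <-] [q <-]] := (sur u, sur v).
by apply: commute_hom; apply/commute_sym; apply: commute_hom => //.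
Qed.

Definition pair_hom (x y : F2) : {hom F2 -> F2} := free_lift (gen2 x y).

Lemma pair_hom_gens x y : (pair_hom x y u = x) * (pair_hom x y v = y).
Proof. by split; rewrite /= ?gen2E. Qed.

Lemma pair_homE (psi : {hom F2 -> F2}) : psi =1 pair_hom (psi u) (psi v).
Proof. by apply: F2_ext; rewrite ?pair_hom_gens. Qed.

Lemma braid_equiv_eq psi chi : psi =1 chi -> braid_equiv psi chi.
Proof. by move=> E; exists 1, 1 => x; rewrite inn1 braid_aut1 E. Qed.

Lemma braid_aut_s : (braid_aut s u = u^-1 * v * u) * (braid_aut s v = u^-1).
Proof.
by rewrite /s !braid_autM braid_aut_a braid_aut_b; split;
  [exact: sigma_u | exact: sigma_v].
Qed.

(** Up to conjugation the half twist s is the quarter turn of the lattice. *)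
Lemma rotate_equiv x y : braid_equiv (pair_hom x y) (pair_hom y x^-1).
Proof.
apply: braid_equiv_trans (twist_equiv _ x s) _; apply: braid_equiv_eq.
by apply: F2_ext; rewrite twistE braid_aut_s ?homM homV !pair_hom_gens !gnorm.
Qed.

Definition swap : {hom F2 -> F2} := pair_hom v u.

(** As psi does not shorten words, only a letter can be sent to a generator. This
leaves eight signed permutations, forming two orbits under the quarter turn. *)
Lemma nielsen_reduced_surjective (psi : {hom F2 -> F2}) :
  (forall y, exists x, psi x = y) -> nielsen_reduced (fun i => psi (gen i)) ->
  braid_equiv psi idfun \/ braid_equiv psi swap.
Proof.
move=> sur N; set g := fun i => _ in N.
have psiE : psi =1 free_lift g by apply: hom_ext => i; apply/esym/free_lift_gen.
have letter_of i : exists l, letter_val g l = gen i.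
  have [x xE] := sur (gen i); have := len_free_lift x N; rewrite -psiE xE.
  move: xE; rewrite psiE /free_lift; case: (word x) => [|l [|//]].
    by rewrite /word_val big_nil => /(congr1 (@word _)).
  by rewrite /word_val big_seq1; exists l.
have [[l lu] [m mv]] := (letter_of ord0, letter_of ord_max).
have lm : l.1 != m.1.
  apply/eqP => /letter_cases lm; apply: uv_noncommuting.
  rewrite /u /v -lu -mv; case: lm => ->; rewrite ?letter_val_flip //.
  exact/commuteV.
have uvE X Y : psi u = X -> psi v = Y -> braid_equiv (pair_hom X Y) idfun \/
    braid_equiv (pair_hom X Y) swap ->
    braid_equiv psi idfun \/ braid_equiv psi swap.
  by move=> <- <- [] E; [left|right]; apply: braid_equiv_trans E;
    apply/braid_equiv_eq/pair_homE.
have rot X Y chi :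
    braid_equiv (pair_hom Y X^-1) chi -> braid_equiv (pair_hom X Y) chi.
  exact/braid_equiv_trans/rotate_equiv.
have e_u_v : braid_equiv (pair_hom u v) idfun.
  by apply: braid_equiv_eq; apply: F2_ext; rewrite ?pair_hom_gens.
have e_v'_u : braid_equiv (pair_hom v^-1 u) idfun by apply: rot; rewrite invgK.
have e_u'_v' : braid_equiv (pair_hom u^-1 v^-1) idfun by apply: rot; rewrite invgK.
have e_v_u' : braid_equiv (pair_hom v u^-1) idfun by apply: rot.
have e_v_u : braid_equiv (pair_hom v u) swap by apply: braid_equiv_refl.
have e_u'_v : braid_equiv (pair_hom u^-1 v) swap by apply: rot; rewrite invgK.
have e_v'_u' : braid_equiv (pair_hom v^-1 u^-1) swap by apply: rot; rewrite invgK.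
have e_u_v' : braid_equiv (pair_hom u v^-1) swap by apply: rot.
case: l m lm lu mv => [i e] [j e'] /=; move: i j.
apply: ord2P; apply: ord2P => // _; rewrite /letter_val /g /= -/u -/v;
  case: e => [/(canRL (@invgK _)) E|E]; case: e' => [/(canRL (@invgK _)) E'|E'];
  by first [apply: (uvE _ _ E E') | apply: (uvE _ _ E' E)]; auto.
Qed.

(** Descent on the total length within the class of psi. *)
Lemma nielsen (psi : {hom F2 -> F2}) :
  (forall y, exists x, psi x = y) ->
  braid_equiv psi idfun \/ braid_equiv psi swap.
Proof.
have [n] := ubnP (total_len psi); elim: n psi => // n IHn psi /ltnSE le sur.
have [[psi' [eq lt]]|min] := pselect (exists psi' : {hom F2 -> F2},
    braid_equiv psi psi' /\ total_len psi' < total_len psi).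
  have sur' y : exists x, psi' x = y.
    have [w [x E]] := eq; have [p pE] := sur (inn w y).
    exists (braid_aut x p); move: pE; rewrite E /=.
    by move/mulIg/mulgI.
  have [E|E] := IHn psi' (leq_trans lt le) sur'; [left|right];
    exact: braid_equiv_trans eq E.
apply: nielsen_reduced_surjective => //; apply: minimal_nielsen_reduced.
  have one i : psi (gen i) = 1 -> commute (psi u) (psi v).
    move: i; apply: ord2P => ->; last exact: commute1.
    exact/commute_sym/commute1.
  by move=> i /one /commuting_not_surjective.
move=> psi' eq; rewrite leqNgt; apply/negP => lt; apply: min.
by exists psi'.
Qed.

(** * Endomorphisms preserving the commutator are surjective *)

Section PathWeight.
Variables (X : choiceType) (e : X -> freeGroup X -> int).
Local Notation lg := (letter_val (@gen X)).
Implicit Types (l : letter X) (w z : seq (letter X)) (g x y : freeGroup X).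

Definition edge_weight l g : int :=
  if l.2 then (- e l.1 (g * (gen l.1)^-1)%g)%R else e l.1 g.

Fixpoint word_weight w g : int :=
  if w is l :: w' then (edge_weight l g + word_weight w' (g * lg l)%g)%R else 0%R.

(** The total weight of the edges on the path from g to g * x labelled by the word
x, where the edge from h to h * gen i has weight e i h and counts negatively
when run backwards. *)
Definition path_weight x g := word_weight (word x) g.

Lemma edge_weight_flip l g : edge_weight (flip l) (g * lg l) = (- edge_weight l g)%R.
Proof.
by case: l => i []; rewrite /edge_weight /letter_val /= ?opprK ?mulgK.
Qed.

Lemma word_weight_push l w g : word_weight (push l w) g = word_weight (l :: w) g.
Proof.
case: w => //= m w; case: eqP => // ->.
by rewrite edge_weight_flip letter_val_flip mulgK addrA subrr add0r.
Qed.

Lemma word_weight_reduce w g : word_weight (reduce w) g = word_weight w g.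
Proof. by elim: w g => //= l w IHw g; rewrite word_weight_push /= IHw. Qed.

Lemma word_weight_cat w z g :
  word_weight (w ++ z) g = (word_weight w g + word_weight z (g * word_val (@gen X) w)%g)%R.
Proof.
elim: w g => [|l w IHw] g; first by rewrite /word_val big_nil mulg1 add0r.
by rewrite /= IHw addrA /word_val big_cons mulgA.
Qed.

Lemma path_weight1 g : path_weight 1 g = 0%R. Proof. by []. Qed.

Lemma path_weightM x y g :
  path_weight (x * y) g = (path_weight x g + path_weight y (g * x)%g)%R.
Proof.
rewrite /path_weight /= word_weight_reduce word_weight_cat.
by rewrite -[word_val _ _]/(free_lift (@gen X) x) word_genE.
Qed.

Lemma path_weight_gen i g : path_weight (gen i) g = e i g.
Proof. exact: addr0. Qed.

Lemma path_weightV x g : path_weight x^-1 g = (- path_weight x (g * x^-1)%g)%R.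
Proof.
have := path_weightM x^-1 x g; rewrite mulVg path_weight1 => /esym/eqP.
by rewrite addr_eq0 => /eqP.
Qed.

(** Weights invariant under H are weights on the Schreier graph of H. *)
Lemma path_weight_invariant (H : {pred freeGroup X}) :
  (forall h i g, h \in H -> e i (h * g) = e i g) ->
  forall h x g, h \in H -> path_weight x (h * g) = path_weight x g.
Proof.
move=> eH h x g hH; rewrite /path_weight; elim: (word x) g => //= l w IHw g.
by rewrite -mulgA IHw; congr (_ + _)%R; rewrite /edge_weight -mulgA !(eH h).
Qed.

End PathWeight.

Lemma commutator_weight (e : 'I_2 -> F2 -> int) :
  path_weight e [~ u, v] 1 =
    (e ord0 (u^-1 * v^-1)%g - e ord0 (u^-1)%g +
     (e ord_max (u^-1 * v^-1 * u)%g - e ord_max (u^-1 * v^-1)%g))%R.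
Proof.
have -> : [~ u, v] = u^-1 * v^-1 * u * v by rewrite commgEl conjgE !mulgA.
rewrite !path_weightM !path_weightV !mul1g -/u -/v !path_weight_gen.
ring.
Qed.

(** On the image H of phi, the weight of a path for H-invariant edge weights is a
homomorphism to the integers, so it vanishes on [~ u, v] = [~ phi u, phi v].
Counting the passages through a suitable edge shows that the loop u^-1 v^-1 u v
must backtrack onto itself. *)
Lemma commutator_image (phi : {hom F2 -> F2}) :
  [~ phi u, phi v] = [~ u, v] -> forall y, exists x, phi x = y.
Proof.
move=> c; pose H : {pred F2} := fun g => `[< exists x, phi x = g >].
have HP g : reflect (exists x, phi x = g) (g \in H) by exact: asboolP.
have H1 : 1 \in H by apply/HP; exists 1; exact: gmulf1.
have HM x y : x \in H -> y \in H -> x * y \in H.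
  by move=> /HP[p <-] /HP[q <-]; apply/HP; exists (p * q); exact: homM.
have HV x : (x^-1 \in H) = (x \in H).
  suff K y : y \in H -> y^-1 \in H.
    by apply/idP/idP => /K //; rewrite invgK.
  by move=> /HP[p <-]; apply/HP; exists p^-1; exact: homV.
have Hl h g : h \in H -> (h * g \in H) = (g \in H).
  move=> hH; apply/idP/idP => [|gH]; last exact: HM.
  by move=> /(HM h^-1); rewrite HV mulKg => /(_ hH).
have closed (e : 'I_2 -> F2 -> int) :
    (forall h i g, h \in H -> e i (h * g) = e i g) -> path_weight e [~ u, v] 1 = 0%R.
  move=> eH; rewrite -c -homR.
  pose n x := path_weight e (phi x) 1.
  have nM x y : n (x * y) = (n x + n y)%R.
    rewrite /n homM path_weightM mul1g; congr (_ + _)%R.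
    rewrite -{1}[phi x]mulg1; apply: path_weight_invariant eH _ _ _ _.
    by apply/HP; exists x.
  rewrite -/(n _); have := commgC u v; move: [~ u, v] => z.
  by move=> /(congr1 n); rewrite !nM (addrC (n v)) -{1}[(n u + n v)%R]addr0 => /addrI.
have cH : [~ u, v] \in H by apply/HP; exists [~ u, v]; rewrite homR.
(* Counting the passages through the edge labelled u that ends at the base
   point of the Schreier graph: the letters u^-1 and u must run through the same
   edge. *)
have uvu : u^-1 * v^-1 * u \in H.
  have : path_weight (fun i g => if i == ord0 then ((g * u)%g \in H)%:R%R else 0%R) [~ u, v] 1 = 0%R.
    by apply: closed => h i g hH; rewrite -mulgA Hl.
  by rewrite commutator_weight /= mulVg H1; case: (_ \in _).
(* Same count for the edge labelled v that starts at the base point. *)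
have uv : u^-1 * v^-1 \in H.
  have : path_weight (fun i g => if i == ord0 then 0%R else (g \in H)%:R%R) [~ u, v] 1 = 0%R.
    by apply: closed => h i g hH; rewrite Hl.
  by rewrite commutator_weight /= uvu; case: (_ \in _).
have vH : v \in H.
  have -> : v = (u^-1 * v^-1 * u)^-1 * [~ u, v] by rewrite commgEl conjgE !gnorm.
  by rewrite HM ?HV.
have uH : u \in H by rewrite -HV -[u^-1](mulgVK v) HM.
move=> y; apply/HP; rewrite -(word_genE y) /free_lift /word_val.
elim/big_rec: _ => // l x _ xH; apply: HM => //.
case: l => i e; rewrite /letter_val /=; case: e; rewrite ?HV; move: i; exact: ord2P.
Qed.

(** * Signed area and the determinant *)

Section Area.
Local Open Scope ring_scope.
Local Notation ua x := (abelianize x ord0 0).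
Local Notation va x := (abelianize x ord_max 0).
Implicit Types (x y z g h : F2) (phi : {hom F2 -> F2}).

(** With weight the exponent of v on the edges labelled u, the weight of a path is
the integral of y dx along its projection to the plane lattice. *)
Definition area_form (i : 'I_2) g : int := if i == ord0 then va g else 0.
Definition area x := path_weight area_form x 1%g.

Lemma uaM x y : ua (x * y)%g = ua x + ua y.
Proof. by rewrite abelianizeM mxE. Qed.
Lemma vaM x y : va (x * y)%g = va x + va y.
Proof. by rewrite abelianizeM mxE. Qed.

(** A translation by g changes the integral of y dx by the height of g times the
horizontal displacement. *)
Lemma area_shift x g h :
  path_weight area_form x g = path_weight area_form x h + (va g - va h) * ua x.
Proof.
rewrite /path_weight [ua x]mxE; elim: (word x) g h => [|l w IHw] g h.
  by rewrite big_nil mulr0 addr0.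
have edge : edge_weight area_form l g =
    edge_weight area_form l h + (va g - va h) * letter_exp ord0 l.
  case: l => i e; rewrite /edge_weight /letter_exp /area_form /=.
  case: (i =P ord0) => [->|_]; last by case: e; rewrite mulr0 ?oppr0 addr0.
  case: e => /=; last by ring.
  by rewrite !vaM abelianizeV abelianize_gen !mxE /=; ring.
by rewrite big_cons /= edge (IHw _ (h * letter_val (@gen _) l)%g) !vaM; ring.
Qed.

Lemma areaM x y : area (x * y)%g = area x + area y + va x * ua y.
Proof.
rewrite /area path_weightM mul1g -addrA; congr (_ + _).
by rewrite (area_shift _ _ 1%g) abelianize1 [(0 : 'cV_2) _ _]mxE subr0.
Qed.

Lemma abelianizeR x y : abelianize [~ x, y]%g = 0.
Proof.
have := congr1 abelianize (commgC x y); rewrite !abelianizeM.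
by rewrite (addrC (abelianize y)) -[LHS]addr0 => /addrI.
Qed.

Lemma areaR x y : area [~ x, y]%g = va x * ua y - va y * ua x.
Proof.
have := congr1 area (commgC x y); rewrite !areaM abelianizeR [(0 : 'cV_2) _ _]mxE.
by rewrite mulr0 addr0 => E; rewrite -[LHS](addKr (area y + area x)); lia.
Qed.

(** Conjugation does not change the area of a path that projects to a closed loop. *)
Lemma area_conj x y z : (y * x = z * y)%g -> ua z = 0 -> va z = 0 ->
  area x = area z.
Proof.
move=> E z0 z0'; have := congr1 area E; rewrite !areaM.
have /(congr1 (fun A : 'cV_2 => A ord0 0)) := congr1 abelianize E.
rewrite !uaM z0 z0'; nia.
Qed.

Lemma det_mx22 (M : 'M[int]_2) :
  \det M = M ord0 ord0 * M ord_max ord_max - M ord0 ord_max * M ord_max ord0.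
Proof.
rewrite (expand_det_row _ ord0) !big_ord_recl big_ord0 /cofactor !det_mx11 !mxE /=.
have -> : lift ord0 ord0 = ord_max :> 'I_2 by exact: val_inj.
have -> : lift ord_max 0 = ord0 :> 'I_2 by exact: val_inj.
by rewrite /bump /= addn0 expr0 expr1; ring.
Qed.

(** The commutator of x and y encloses the parallelogram spanned by their classes, so
its area is minus a determinant. *)
Lemma commutator_det phi (w : F2) :
  ([~ phi u, phi v] = w^-1 * [~ u, v] * w)%g -> \det (rho_mx phi) = 1.
Proof.
move=> E; have : area [~ phi u, phi v]%g = area [~ u, v]%g.
  by apply: (@area_conj _ w); rewrite ?abelianizeR ?mxE // E !mulgA mulgV mul1g.
rewrite !areaR det_mx22 !abelianize_gen !mxE -/u -/v /=.
lia.
Qed.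
End Area.

(** * The action of braids on the commutator and on the lattice *)

Lemma B3_ind (P : B3 -> Prop) : P 1 ->
  (forall x, P x -> P (a * x)) -> (forall x, P x -> P (a^-1 * x)) ->
  (forall x, P x -> P (b * x)) -> (forall x, P x -> P (b^-1 * x)) ->
  forall x, P x.
Proof.
move=> P1 Pa Pa' Pb Pb' x; pose c := cls (normal_closure braid_relator).
have cM p q : c (p * q) = c p * c q by exact: gmulfM.
have cV p : c p^-1 = (c p)^-1 by exact: gmulfV.
rewrite -(clsK x) -/(c _) -(word_genE (cls_repr x)) /free_lift /word_val.
elim: (word _) => [|l w IHw]; first by rewrite big_nil.
rewrite big_cons cM; case: l => i e; rewrite /letter_val /=.
case: e; rewrite ?cV; move: i; apply: ord2P; by [exact: Pa' | exact: Pb' | exact: Pa | exact: Pb].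
Qed.

Lemma braid_aut_commutator x : braid_aut x [~ u, v] = [~ u, v].
Proof.
have inv (f : aut F2) : f [~ u, v] = [~ u, v] -> f^-1 [~ u, v] = [~ u, v].
  by move=> fc; rewrite -{1}fc -autME mulVg.
have fa : alpha [~ u, v] = [~ u, v].
  transitivity [~ alpha u, alpha v]; first exact: homR.
  by rewrite alpha_u alpha_v; apply: val_inj; vm_compute.
have fb : beta [~ u, v] = [~ u, v].
  transitivity [~ beta u, beta v]; first exact: homR.
  by rewrite beta_u beta_v; apply: val_inj; vm_compute.
elim/B3_ind: x => [|x IH|x IH|x IH|x IH]; first by rewrite braid_aut1.
all: rewrite braid_autM autME IH ?braid_aut_aV ?braid_aut_bV ?braid_aut_a ?braid_aut_b //.
all: exact: inv.
Qed.

Section BraidMatrices.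
Local Open Scope ring_scope.

Definition braid_mx (x : B3) : 'M[int]_2 := rho_mx (braid_aut x).

Lemma braid_mxM x y : braid_mx (x * y)%g = braid_mx x *m braid_mx y.
Proof. by rewrite /braid_mx -rho_mxM braid_autM. Qed.
Lemma braid_mx1 : braid_mx 1%g = 1%:M.
Proof. by rewrite -rho_mx1 /braid_mx braid_aut1. Qed.

Lemma rho_mx_ext (f g : {hom F2 -> F2}) : f =1 g -> rho_mx f = rho_mx g.
Proof. by move=> E; apply/matrixP => i j; rewrite !mxE E. Qed.

Lemma rho_mx_inn w : rho_mx (inn w) = 1%:M.
Proof.
apply/matrixP => i j; rewrite mxE [X in abelianize X]/= !abelianizeM abelianizeV abelianize_gen.
by rewrite addrC addKr !mxE andbT.
Qed.

Lemma det_braid_mx x : \det (braid_mx x) = 1.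
Proof.
apply: (@commutator_det (braid_aut x) 1%g).
by rewrite mulg1 invg1 mul1g -[RHS](braid_aut_commutator x) [RHS]homR.
Qed.

(** Positive words in a^-1 and b; their matrices are the nonnegative ones. *)
Definition positive_word (w : seq bool) : B3 :=
  (\prod_(e <- w) if e then b else a^-1)%g.

Definition mx22 (p q r t : int) : 'M[int]_2 :=
  \matrix_(i, j) if i == ord0 then (if j == ord0 then p else q)
                 else (if j == ord0 then r else t).

Lemma mx22M p q r t p' q' r' t' : mx22 p q r t *m mx22 p' q' r' t' =
  mx22 (p * p' + q * r') (p * q' + q * t') (r * p' + t * r') (r * q' + t * t').
Proof.
by apply/matrixP; apply: ord2P; apply: ord2P; rewrite !mxE !big_ord_recl big_ord0 !mxE /= addr0.
Qed.

Lemma mx22_inj p q r t p' q' r' t' : mx22 p q r t = mx22 p' q' r' t' ->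
  [/\ p = p', q = q', r = r' & t = t'].
Proof.
move=> /matrixP E.
by have := (E ord0 ord0, E ord0 ord_max, E ord_max ord0, E ord_max ord_max); rewrite !mxE => -[[[]]].
Qed.

Lemma mx22_1 : 1%:M = mx22 1 0 0 1.
Proof. by apply/matrixP; apply: ord2P; apply: ord2P; rewrite !mxE. Qed.

Lemma rho_mx22 (f : {hom F2 -> F2}) : rho_mx f =
  mx22 (abelianize (f u) ord0 0) (abelianize (f v) ord0 0)
       (abelianize (f u) ord_max 0) (abelianize (f v) ord_max 0).
Proof. by apply/matrixP; apply: ord2P; apply: ord2P; rewrite !mxE. Qed.

Lemma braid_mx22 x U V : braid_aut x u = U -> braid_aut x v = V ->
  braid_mx x = mx22 (abelianize U ord0 0) (abelianize V ord0 0)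
                    (abelianize U ord_max 0) (abelianize V ord_max 0).
Proof. by move=> <- <-; exact: rho_mx22. Qed.

Lemma braid_mx_aV : braid_mx a^-1 = mx22 1 1 0 1.
Proof.
rewrite (@braid_mx22 _ u (u * v)%g) ?braid_aut_aV ?alphaV_u ?alphaV_v //.
by rewrite abelianizeM !abelianize_gen !mxE.
Qed.
Lemma braid_mx_b : braid_mx b = mx22 1 0 1 1.
Proof.
rewrite (@braid_mx22 _ (v * u)%g v) ?braid_aut_b ?beta_u ?beta_v //.
by rewrite abelianizeM !abelianize_gen !mxE.
Qed.
Lemma braid_mx_s : braid_mx s = mx22 0 (-1) 1 0.
Proof.
rewrite (braid_mx22 braid_aut_s.1 braid_aut_s.2).
by rewrite !abelianizeM !abelianizeV !abelianize_gen !mxE.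
Qed.

(** The entries are written as natural numbers to record their signs; each letter
adds at least 1 to the off-diagonal entries because the diagonal ones are
positive. *)
Lemma positive_word_mx w : exists p q r t : nat,
  braid_mx (positive_word w) = mx22 (p%:Z + 1) q%:Z r%:Z (t%:Z + 1) /\ (size w <= q + r)%N.
Proof.
elim: w => [|e w [p [q [r [t [E le]]]]]].
  exists 0%N, 0%N, 0%N, 0%N; rewrite /positive_word big_nil braid_mx1 mx22_1.
  by split=> //; congr mx22.
rewrite /positive_word big_cons -/(positive_word w) braid_mxM E; case: e.
  exists p, q, (p + r).+1, (q + t)%N.
  by rewrite braid_mx_b mx22M; split; [congr mx22; lia | rewrite /=; lia].
exists (p + r)%N, (q + t).+1, r, t.
by rewrite braid_mx_aV mx22M; split; [congr mx22; lia | rewrite /=; lia].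
Qed.
End BraidMatrices.

(** * The kernel of the map from B3 to SL(2, Z) *)

(** Conjugation by t exchanges x and y, so a power of t either exchanges or fixes
them. *)
Lemma swap_power (G : groupType) (x y t z : G) : t * x = y * t -> t * y = x * t ->
  z \in cyclic_subgroup t ->
  (x * z = z * x /\ y * z = z * y) \/ (x * z = z * y /\ y * z = z * x).
Proof.
move=> tx ty; have inv (p q r : G) : p * r = r * q -> q * r^-1 = r^-1 * p.
  by move=> E; apply: (mulgI r); rewrite mulVKg mulgA -E mulgK.
have pow n : (x * t ^+ n = t ^+ n * x /\ y * t ^+ n = t ^+ n * y) \/
    (x * t ^+ n = t ^+ n * y /\ y * t ^+ n = t ^+ n * x).
  elim: n => [|n IH]; first by left; rewrite !mulg1 !mul1g.
  rewrite expgS !mulgA -tx -ty -!mulgA.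
  by case: IH => -[-> ->]; [right|left].
case/cyclic_subgroupP => n [] -> //.
by case: (pow n) => -[/inv Ea /inv Eb]; [left|right].
Qed.

Lemma intertwineV (G : groupType) (x y t : G) : y * t = t * x -> y^-1 * t = t * x^-1.
Proof. by move=> E; apply: (mulgI y); rewrite mulVKg mulgA E mulgK. Qed.

Section NormalForm.
Local Notation C := (cyclic_subgroup s).

Lemma sa : s * a = b * s. Proof. by rewrite {1}/s braid_rel /s !mulgA. Qed.
Lemma sb : s * b = a * s. Proof. by rewrite [in RHS]/s braid_rel /s !mulgA. Qed.

Lemma s_in : s \in C.
Proof. by apply/cyclic_subgroupP; exists 1%N; left; rewrite expg1. Qed.

Lemma conj_s_power t : t \in C ->
  (a * t = t * a /\ b * t = t * b) \/ (a * t = t * b /\ b * t = t * a).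
Proof. by apply: swap_power; [exact: sa | exact: sb]. Qed.

Definition normal_form x := exists t1 w t2,
  [/\ t1 \in C, t2 \in C & x = t1 * positive_word w * t2].

Lemma normal_form_mul x t1 t2 : t1 \in C -> t2 \in C ->
  normal_form x -> normal_form (t1 * x * t2).
Proof.
move=> C1 C2 [t1' [w [t2' [C1' C2' ->]]]]; exists (t1 * t1'), w, (t2' * t2).
by split; rewrite ?gpredM // !mulgA.
Qed.

(** A wrong letter next to a positive word is absorbed by a power of s:
a b = s a^-1 and b^-1 a^-1 = s^-1 b. Next to the empty word, a and b^-1 are
conjugate under s to b and a^-1. *)
Lemma normal_form_letter w :
  [/\ normal_form (a * positive_word w), normal_form (a^-1 * positive_word w),
      normal_form (b * positive_word w) & normal_form (b^-1 * positive_word w)].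
Proof.
have pos w' : normal_form (positive_word w').
  by exists 1, w', 1; rewrite mulg1 mul1g !gpred1.
have mull t x : t \in C -> normal_form x -> normal_form (t * x).
  by move=> Ct nx; rewrite -[t * x]mulg1; apply: normal_form_mul; rewrite ?gpred1.
have posE e w' : positive_word (e :: w') = (if e then b else a^-1) * positive_word w'.
  by rewrite /positive_word big_cons.
have pos0 : positive_word [::] = 1 by rewrite /positive_word big_nil.
have na w' : normal_form (a^-1 * positive_word w') by rewrite -(posE false).
have nb w' : normal_form (b * positive_word w') by rewrite -(posE true).
split; [|exact: na|exact: nb|]; case: w => [|[] w]; rewrite ?pos0 ?mulg1 ?posE ?mulgA.
- have -> : a = s * b * s^-1 by rewrite sb mulgK.
  apply: normal_form_mul; rewrite ?gpredV ?s_in //.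
  by have := pos [:: true]; rewrite posE pos0 mulg1.
- have -> : a * b = s * a^-1 by rewrite mulgK.
  by rewrite -mulgA; apply: mull s_in _; exact: na.
- by rewrite mulgV mul1g.
- have -> : b^-1 = s * a^-1 * s^-1.
    by rewrite -(intertwineV (esym sa)) mulgK.
  apply: normal_form_mul; rewrite ?gpredV ?s_in //.
  by have := pos [:: false]; rewrite posE pos0 mulg1.
- by rewrite mulVg mul1g.
- have -> : b^-1 * a^-1 = s^-1 * b.
    by apply: (mulgI s); rewrite mulVKg {1}/s braid_rel !mulgA !mulgK.
  by rewrite -mulgA; apply: mull; rewrite ?gpredV ?s_in //; exact: nb.
Qed.

(** Left multiplication by a letter: move it across the power of s, which may turn a
into b, then absorb it in the positive word. *)
Lemma normal_form_all x : normal_form x.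
Proof.
have step (g g' : B3) :
    (forall t, t \in C -> g * t = t * g \/ g * t = t * g') ->
    (forall w, normal_form (g * positive_word w)) ->
    (forall w, normal_form (g' * positive_word w)) ->
    forall y, normal_form y -> normal_form (g * y).
  move=> gt ng ng' _ [t1 [w [t2 [C1 C2 ->]]]]; rewrite !mulgA.
  by case: (gt t1 C1) => ->; rewrite -(mulgA t1); apply: normal_form_mul.
have nf w := normal_form_letter w.
elim/B3_ind: x => [|y|y|y|y].
- by exists 1, [::], 1; rewrite /positive_word big_nil !mulg1 !gpred1.
- apply: (@step a b) => [t /conj_s_power [] []|w|w]; try by case: (nf w).
    by left.
  by right.
- apply: (@step a^-1 b^-1) => [t /conj_s_power [] []|w|w]; try by case: (nf w).
    by move/intertwineV; left.
  by move/intertwineV; right.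
- apply: (@step b a) => [t /conj_s_power [] []|w|w]; try by case: (nf w).
    by left.
  by right.
- apply: (@step b^-1 a^-1) => [t /conj_s_power [] []|w|w]; try by case: (nf w).
    by move=> _ /intertwineV; left.
  by move=> _ /intertwineV; right.
Qed.

Local Notation C4 := (cyclic_subgroup (s ^+ 4)).

(** Negative powers are handled by s^-n = s^(3n) * s^-(4n). *)
Lemma s_power_mod4 t : t \in C -> exists2 k, k < 4 & exists2 z, z \in C4 & t = s ^+ k * z.
Proof.
have s4V n : (s ^+ 4) ^- n \in C4 by apply/cyclic_subgroupP; exists n; right.
have s4 n : (s ^+ 4) ^+ n \in C4 by apply/cyclic_subgroupP; exists n; left.
have pow n z : z \in C4 -> exists2 k, k < 4 & exists2 z', z' \in C4 & s ^+ n * z = s ^+ k * z'.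
  move=> zC; exists (n %% 4)%N; first by rewrite ltn_mod.
  exists ((s ^+ 4) ^+ (n %/ 4) * z); first by rewrite gpredM.
  by rewrite mulgA -expgnA -expgnDr addnC mulnC -divn_eq.
case/cyclic_subgroupP => n [] ->; first by rewrite -[s ^+ n]mulg1; apply: pow; rewrite gpred1.
have -> : s ^- n = s ^+ (3 * n) * (s ^+ 4) ^- n; last exact: pow.
apply: (mulgI (s ^+ n)); rewrite mulgV mulgA -expgnDr -expgnA.
by rewrite (_ : n + 3 * n = 4 * n)%N ?mulgV //; lia.
Qed.

Lemma braid_mx_C4 z : z \in C4 -> braid_mx z = 1%:M%R.
Proof.
move=> /braid_aut_Y /innerP [w E].
by rewrite /braid_mx E rho_mx_inn.
Qed.

Lemma braid_mx_power k : k < 4 -> braid_mx (s ^+ k) =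
  (nth 0 [:: mx22 1 0 0 1; mx22 0 (-1) 1 0; mx22 (-1) 0 0 (-1); mx22 0 1 (-1) 0] k)%R.
Proof.
have E n : braid_mx (s ^+ n.+1) = (mx22 0 (-1) 1 0 *m braid_mx (s ^+ n))%R.
  by rewrite expgS braid_mxM braid_mx_s.
case: k => [|[|[|[|//]]]] _; rewrite ?E ?expg0 braid_mx1 mx22_1 ?mx22M //.
all: by congr mx22.
Qed.

(** If x = t1 * w * t2 has trivial matrix, the matrix of w is that of a power of s, a
quarter turn. Its diagonal is positive, so it is the identity, and then w is
empty by positive_word_mx. *)
Lemma braid_mx_kernel x : braid_mx x = 1%:M%R -> x \in C4.
Proof.
have [t1 [w [t2 [C1 C2 xE]]]] := normal_form_all x => x1.
have wE : positive_word w = t1^-1 * x * t2^-1.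
  by rewrite xE !mulgA mulVg mul1g mulgK.
have : t1^-1 * t2^-1 \in C by rewrite gpredM ?gpredV.
case/s_power_mod4 => k k4 [z Cz tE].
have [p [q [r [t [wM le]]]]] := positive_word_mx w.
have sM : braid_mx (s ^+ k) = mx22 (p%:Z + 1) q%:Z r%:Z (t%:Z + 1)%R.
  rewrite -wM wE !braid_mxM x1 mulmx1 -braid_mxM tE braid_mxM (braid_mx_C4 Cz).
  by rewrite mulmx1.
have w0 : w = [::].
  apply/size0nil/eqP; rewrite -leqn0; apply: leq_trans le _.
  move: sM; rewrite braid_mx_power //.
  by case: k k4 {tE} => [|[|[|[|//]]]] _ /mx22_inj[]; lia.
have : x \in C by rewrite xE w0 /positive_word big_nil mulg1 gpredM.
case/s_power_mod4 => j j4 [z' Cz' E]; move: x1.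
rewrite E braid_mxM (braid_mx_C4 Cz') mulmx1 braid_mx_power //.
case: j j4 {E} (E) => [|[|[|[|//]]]] _ E; rewrite mx22_1 => /mx22_inj[] //.
by rewrite mul1g.
Qed.
End NormalForm.

(** * The centralizer of the commutator *)

Section CommutatorCentralizer.
Local Notation F := (Group.sort (Defs_freeGroup__canonical__monoid_Group 'I_2)).
Local Notation c := ([~ u, v] : F).

Lemma len_c : len c = 4. Proof. by vm_compute. Qed.
Lemma gp_cV_c : gp c^-1 c = 0. Proof. by vm_compute. Qed.

(** No cancellation occurs in c * w = w * c, so c and w are both prefixes of this
element and one is a prefix of the other; the proper prefixes of c of length 1
and 2 do not commute with c. *)
Lemma centralizer_overlap (w : F) :
  w <> 1 -> commute w c -> gp c^-1 w = 0 -> 2 < gp c w.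
Proof.
move=> w1 cw g0; have lc := len_c.
have cz : gp c (w * c) = 4 by have := gp_mulr c w; rewrite cw; lia.
have wz : gp w (w * c) = len w.
  have := lenM c w; have := lenM w c; have := gp_mulr w c; rewrite cw; lia.
have := gp_hyperbolic c (w * c) w; rewrite (gpC _ w) wz cz => le.
have [//|lt] := ltnP 2 (gp c w); exfalso.
have n0 : len w <> 0 by move/len_eq0.
have gw : gp w c = len w by rewrite gpC; have := gp_le w c; rewrite gpC; lia.
have := congr1 (@word _) cw; rewrite /= (lcp_full gw).
have : len w = 1%N \/ len w = 2%N by lia.
by rewrite -/(len w); case=> ->; move/eqP; vm_compute.
Qed.

(** Either w or w^-1 does not cancel against c on the left, because c and c^-1 begin
with distinct letters. By centralizer_overlap that element becomes shorter when
multiplied by c^-1. *)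
Lemma commutator_centralizer (w : F) : commute w c -> w \in cyclic_subgroup c.
Proof.
have [n] := ubnP (len w); elim: n w => // n IHn w /ltnSE lw cw.
have lc := len_c.
have c_in : c \in cyclic_subgroup c.
  by apply/cyclic_subgroupP; exists 1%N; left; rewrite expg1.
have step (t : F) : len t <= n -> commute t c -> gp c^-1 t = 0 ->
    t \in cyclic_subgroup c.
  move=> lt ct g0; have [->|/eqP t1] := eqVneq t 1; first exact: gpred1.
  have := centralizer_overlap t1 ct g0; have := gpE c t => d o.
  rewrite -(mulVKg c t) gpredM //; apply: IHn; first by rewrite -/(dist _ _); lia.
  apply/commute_sym/commuteM; last exact/commute_sym.
  exact/commuteV/commute_refl.
have [g0|g0] := posnP (gp c^-1 w); last first.
  rewrite -gpredV; apply: step; rewrite ?lenV //.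
    exact/commute_sym/commuteV/commute_sym.
  have gw : gp w^-1 c = gp c^-1 w by have := lenM c w; have := lenM w c; rewrite cw; lia.
  by have := gp_hyperbolic c^-1 w^-1 c; rewrite gp_cV_c; lia.
exact: step.
Qed.
End CommutatorCentralizer.

(** * Direct automorphisms and the amalgamated product *)

Lemma swapK : cancel swap swap.
Proof.
have E : swap \o swap =1 idfun.
  by apply: F2_ext; rewrite /= ?gen2E.
exact: E.
Qed.

Definition swap_aut : aut F2 := Aut (hom_monoid_morphism swap) swapK swapK.

Lemma surjective_automorphism (phi : {hom F2 -> F2}) :
  (forall y, exists x, phi x = y) -> exists f : aut F2, phi =1 f.
Proof.
move=> /nielsen [] [w [x E]]; first by exists (inn w * braid_aut x).
by exists (inn w * swap_aut * braid_aut x).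
Qed.

Lemma det_rho_equiv (phi chi : {hom F2 -> F2}) : braid_equiv phi chi ->
  (\det (rho_mx phi) = \det (rho_mx chi))%R.
Proof.
move=> [w [x E]].
have -> : rho_mx phi = (rho_mx (inn w) *m (rho_mx chi *m braid_mx x))%R.
  rewrite -!rho_mxM; exact: rho_mx_ext.
by rewrite rho_mx_inn mul1mx det_mulmx det_braid_mx mulr1.
Qed.

Lemma det_swap : (\det (rho_mx swap) = -1)%R.
Proof.
have -> : rho_mx swap = mx22 0 1 1 0.
  by rewrite rho_mx22 !pair_hom_gens !abelianize_gen !mxE.
by rewrite det_mx22 !mxE.
Qed.

Lemma surjective_det1 (phi : {hom F2 -> F2}) :
  (forall y, exists x, phi x = y) -> (\det (rho_mx phi) = 1)%R ->
  exists w x, phi =1 inn w * braid_aut x.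
Proof.
move=> /nielsen [[w [x E]] _|/det_rho_equiv ->]; first by exists w, x.
by rewrite det_swap.
Qed.

Lemma directE (f : aut F2) : (f \in direct) = (\det (rho_mx f) == 1)%R.
Proof. by []. Qed.

Lemma direct_decomposition (f : aut F2) :
  f \in direct -> exists w x, f = inn w * braid_aut x.
Proof.
rewrite directE => /eqP /surjective_det1 []; first by move=> y; exists (f^-1 y); exact: aut_invK.
by move=> w [x E]; exists w, x; exact: aut_eqP.
Qed.

Lemma inner_direct (f : aut F2) : f \in inner F2 -> f \in direct.
Proof. by move=> /innerP [w ->]; rewrite directE rho_mx_inn det1. Qed.

Lemma braid_direct x : braid_aut x \in direct.
Proof. by rewrite directE -[rho_mx _]/(braid_mx x) det_braid_mx. Qed.

Lemma rho_eq1 (f : aut F2) : rho f = 1 <-> rho_mx f = 1%:M%R.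
Proof. by split=> [/(congr1 (@GL_mx _ _))|] //; move=> E; apply: val_inj. Qed.

(** An automorphism with trivial matrix is inn w composed with a braid of trivial
matrix, that is, with a power of s^4, which acts as a power of inn [~ u, v]. *)
Lemma inner_kernel (f : aut F2) : f \in inner F2 <-> rho f = 1.
Proof.
rewrite rho_eq1; split=> [/innerP [w ->]|f1]; first exact: rho_mx_inn.
have [w [x fE]] : exists w x, f = inn w * braid_aut x.
  by apply: direct_decomposition; rewrite directE f1 det1.
have : braid_mx x = 1%:M%R.
  rewrite -f1 fE [RHS](rho_mxM (inn w) (braid_aut x)) rho_mx_inn.
  by rewrite mul1mx.
move/braid_mx_kernel/braid_aut_Y => xin.
by rewrite fE gpredM //; apply/innerP; exists w.
Qed.

Section Amalgam.
Local Notation SD := (sdprod psi).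

Lemma sd_val_direct (p : SD) : sub_val (sd_l p) * braid_aut (sd_r p) \in direct.
Proof. by rewrite gpredM ?braid_direct //; apply/inner_direct/(valP (sd_l p)). Qed.

Definition sd_val (p : SD) : Aut^+ := Subgroup (sd_val_direct p).

Fact sd_val_morphism : monoid.monoid_morphism sd_val.
Proof.
split=> [|[h x] [h' x']]; apply: val_inj.
  by transitivity ((1 : aut F2) * braid_aut 1) => //; rewrite braid_aut1 mulg1.
pose f := braid_aut x.
transitivity (sub_val h * (f * sub_val h' * f^-1) * braid_aut (x * x')) => //.
transitivity (sub_val h * f * (sub_val h' * braid_aut x')) => //.
by rewrite braid_autM !mulgA mulgVK.
Qed.

Definition sd_val_hom : {hom SD -> Aut^+} :=
  HB.pack sd_val (isUMagmaMorphism.Build _ _ sd_val sd_val_morphism).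

Fact sd_val_mu p : p \in mu Y_amalgam -> sd_val_hom p = 1.
Proof. by move=> /muP [m ->]; apply: val_inj; rewrite /= mulVg. Qed.

Definition amalgam_val : {hom amalgamated_sdprod Y_amalgam -> Aut^+} :=
  quotient_lift sd_val_mu.

Lemma amalgam_valE h x :
  sub_val (amalgam_val (amalgamated_pair Y_amalgam h x)) = sub_val h * braid_aut x.
Proof. by rewrite /amalgam_val /amalgamated_pair quotient_liftE. Qed.

(** If h * braid_aut x = 1 then braid_aut x is inner, so x is a power of s^4 by
braid_mx_kernel, and the pair belongs to mu. *)
Lemma amalgam_val_inj : injective amalgam_val.
Proof.
apply: gmulf_inj => q; rewrite -(clsK q); case: (cls_repr q) => h x.
move=> /(congr1 (@sub_val _ _)); rewrite [LHS]amalgam_valE => hx.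
have xin : x \in cyclic_subgroup (s ^+ 4).
  apply: braid_mx_kernel; apply/rho_eq1/inner_kernel.
  have -> : braid_aut x = (sub_val h)^-1 by apply/esym/mulg1_eq.
  by rewrite gpredV; exact: (valP h).
have -> : SDPair psi h x = mu_elt (Subgroup xin : Y_amalgam).
  congr SDPair; apply: val_inj.
  by apply: invg_inj; rewrite -[RHS]/(val (Y_Int (Subgroup xin))^-1^-1) invgK; exact: mulg1_eq.
by apply/esym/clsP; rewrite invg1 mul1g; apply/muP; exists (Subgroup xin).
Qed.

Lemma amalgam_val_surj f : exists q, amalgam_val q = f.
Proof.
have [w [x fE]] := direct_decomposition (valP f).
have iw : inn w \in inner F2 by apply/innerP; exists w.
exists (amalgamated_pair Y_amalgam (Subgroup iw) x); apply: val_inj.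
by rewrite [LHS]amalgam_valE [RHS]fE.
Qed.

End Amalgam.

Lemma inn_commutator_braid w : w \in cyclic_subgroup [~ u, v] ->
  exists y, braid_aut y = inn w.
Proof.
have pow n : braid_aut ((s ^+ 4) ^+ n) = inn ([~ u, v] ^+ n).
  transitivity (braid_aut (s ^+ 4) ^+ n); first exact: gmulfXn.
  by rewrite braid_aut_s4; exact/esym/gmulfXn.
case/cyclic_subgroupP => n [] ->; first by exists ((s ^+ 4) ^+ n).
by exists ((s ^+ 4) ^- n); rewrite braid_autV pow innV.
Qed.

Theorem mainTheorem4 :
  [/\ forall phi : {hom F2 -> F2},
        (forall y : F2, exists x : F2, phi x = y) -> exists f : aut F2, phi =1 f,
      exists Phi : {hom amalgamated_sdprod Y_amalgam -> Aut^+},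
        bijective Phi /\
        forall (h : Int F2) (x : B3),
          sub_val (Phi (amalgamated_pair Y_amalgam h x)) =1 sub_val h \o braid_aut x,
      forall f : aut F2, f \in inner F2 <-> rho f = 1
    & (forall phi : {hom F2 -> F2},
        (exists2 f : aut F2, f \in direct & phi =1 f) <->
        (exists w : F2, [~ phi u, phi v] = w^-1 * [~ u, v] * w)) /\
      (forall phi : {hom F2 -> F2},
        (exists x : B3, phi =1 braid_aut x) <-> [~ phi u, phi v] = [~ u, v])].
Proof.
have conj_braid (phi : {hom F2 -> F2}) w :
    [~ phi u, phi v] = w^-1 * [~ u, v] * w -> exists w x, phi =1 inn w * braid_aut x.
  move=> E; apply: surjective_det1 (commutator_det E).
  pose psi' : {hom F2 -> F2} := inn w \o phi.
  have c : [~ psi' u, psi' v] = [~ u, v].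
    transitivity (inn w [~ phi u, phi v]); first exact/esym/homR.
    by rewrite E innE !mulgA mulgV mul1g mulgK.
  move=> y; have [x xE] := commutator_image c (inn w y).
  by exists x; move: xE => /mulIg/mulgI.
split.
- exact: surjective_automorphism.
- exists amalgam_val; split; last by move=> h x y; rewrite amalgam_valE.
  pose g f := sval (cid (amalgam_val_surj f)).
  have gK : cancel g amalgam_val by move=> f; rewrite /g; case: cid.
  exists g => // q; exact/amalgam_val_inj/gK.
- exact: inner_kernel.
split=> phi; split.
- move=> [f /direct_decomposition [w [x ->]] E]; exists w^-1.
  by rewrite -homR E autME braid_aut_commutator innE invgK.
- move=> [w /conj_braid [w' [x E]]]; exists (inn w' * braid_aut x) => //.
  by rewrite gpredM ?braid_direct //; apply: inner_direct; apply/innerP; exists w'.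
- by move=> [x E]; rewrite -homR E braid_aut_commutator.
move=> c.
have [w [x E]] : exists w x, phi =1 inn w * braid_aut x.
  by apply: (conj_braid _ 1); rewrite invg1 mul1g mulg1.
have /commutator_centralizer/inn_commutator_braid [y yE] : commute w [~ u, v].
  apply: (mulIg w^-1); rewrite mulgK -[RHS]c -homR E autME braid_aut_commutator.
  by rewrite innE.
by exists (y * x) => p; rewrite E braid_autM yE.
Qed.
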